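(* For any maximal toral subalgebra $\mathfrak{t}\subseteq\mathfrak{so}(V)$, we have $$\mathfrak{z}_{\mathfrak{so}(V)}(\mathfrak{t})=\mathfrak{t}\oplus\textstyle\bigwedge^2V^0,$$ which is a Lie algebra nilpotent of depth at most $2$.
   Context: Everything is over $\mathbb{C}$. $V$ is a countably infinite-dimensional vector space with a nondegenerate symmetric bilinear form $\langle\cdot,\cdot\rangle$. $V\otimes V$ is an associative algebra with $(v\otimes w)\cdot(v'\otimes w')=\langle v',w\rangle\,v\otimes w'$, acting on $V$ by $(v\otimes w)\cdot u=\langle u,w\rangle v$; $v\wedge w=v\otimes w-w\otimes v$, $\bigwedge^2A$ is the span of $v\wedge w$ with $v,w\in A$, and $\mathfrak{so}(V)=\bigwedge^2V$ with the commutator bracket. $\mathfrak{so}(V)$ is a union of nested finite-dimensional reductive subalgebras, each reductive in the next; an element is semisimple if it is semisimple in these (equivalently in all large enough ones), and a subalgebra is toral if all its elements are semisimple. $V^0:=\{m\in V:\exists\, i\in\mathbb{Z}_{>0}\text{ such that }x^i\cdot m=0\ \forall x\in\mathfrak{t}\}$ is the generalized zero weight space of $\mathfrak{t}$ in $V$. $\mathfrak{z}_{\mathfrak{so}(V)}(\mathfrak{t})$ is the centralizer of $\mathfrak{t}$. ''Nilpotent of depth at most $2$'' means $[[\mathfrak{k},\mathfrak{k}],\mathfrak{k}]=0$. *)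

(* Defs.v *)
From HB Require Import structures.
From mathcomp Require Import all_boot all_order all_algebra.
From mathcomp Require Import generic_quotient boolp classical_sets.

Set Implicit Arguments.
Unset Strict Implicit.
Unset Printing Implicit Defensive.

Import GRing.Theory.

Local Open Scope classical_set_scope.
Local Open Scope quotient_scope.
Local Open Scope ring_scope.

(** * Tensor products

   [tensor U V] consists of the formal sums [u_1 (x) v_1 + ... + u_k (x) v_k],
   coded as lists of pairs; two formal sums are identified when every bilinear
   map takes the same value on both. The universal property is given by
   [tens_bilinear], [tlift_linear], [tlift_tens] and [tlift_unique]. *)

Section Tensor.
Context {K : fieldType}.
Variables U V : lmodType K.

Definition formal_eval (W : lmodType K) (f : U -> V -> W) (s : seq (U * V)) :=
  \sum_(p <- s) f p.1 p.2.

Definition formal_eq (s t : seq (U * V)) : bool :=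
  `[< forall (W : lmodType K) (f : {bilinear U -> V -> W}),
        formal_eval f s = formal_eval f t >].

Lemma formal_eq_equiv : equiv_class_of formal_eq.
Proof.
split=> [s|s t|t s u].
- exact/asboolP.
- by apply/asboolP/asboolP => h W f; rewrite h.
- by move=> /asboolP h1 /asboolP h2; apply/asboolP => W f; rewrite h1 h2.
Qed.

Canonical formal_equivRel := EquivRelPack formal_eq_equiv.
Canonical formal_encModRel := defaultEncModRel formal_eq.

Definition tensor := {eq_quot formal_eq}.
HB.instance Definition _ := Choice.on tensor.
HB.instance Definition _ : EqQuotient _ formal_eq tensor :=
  EqQuotient.on tensor.

Definition tens_scale_seq (a : K) (s : seq (U * V)) :=
  [seq (a *: p.1, p.2) | p <- s].

Definition tens (u : U) (v : V) : tensor := \pi_tensor [:: (u, v)].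
Definition tens0 : tensor := \pi_tensor [::].
Definition tens_add (x y : tensor) : tensor := \pi_tensor (repr x ++ repr y).
Definition tens_scale (a : K) (x : tensor) : tensor :=
  \pi_tensor (tens_scale_seq a (repr x)).
Definition tens_opp (x : tensor) : tensor := tens_scale (- 1) x.

Definition tlift (W : lmodType K) (f : U -> V -> W) (x : tensor) : W :=
  formal_eval f (repr x).

Section Lift.
Context {W : lmodType K}.
Variable f : {bilinear U -> V -> W}.

Lemma formal_eval_cat s t :
  formal_eval f (s ++ t) = formal_eval f s + formal_eval f t.
Proof. exact: big_cat. Qed.

Lemma formal_eval_scale a s :
  formal_eval f (tens_scale_seq a s) = a *: formal_eval f s.
Proof.
rewrite /formal_eval /tens_scale_seq big_map scaler_sumr.
by apply: eq_bigr => p _ /=; rewrite linearZl_LR.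
Qed.

Lemma tlift_pi s : tlift f (\pi_tensor s) = formal_eval f s.
Proof. by move: (reprK (\pi_tensor s)) => /eqmodP /asboolP; apply. Qed.

Lemma tlift0 : tlift f tens0 = 0.
Proof. by rewrite tlift_pi /formal_eval big_nil. Qed.

Lemma tlift_add x y : tlift f (tens_add x y) = tlift f x + tlift f y.
Proof. by rewrite tlift_pi formal_eval_cat. Qed.

Lemma tlift_scale a x : tlift f (tens_scale a x) = a *: tlift f x.
Proof. by rewrite tlift_pi formal_eval_scale. Qed.

Lemma tlift_tens u v : tlift f (tens u v) = f u v.
Proof. by rewrite tlift_pi /formal_eval big_seq1. Qed.
End Lift.

Lemma tensorP (x y : tensor) :
  (forall (W : lmodType K) (f : {bilinear U -> V -> W}),
     tlift f x = tlift f y) -> x = y.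
Proof.
by move=> h; rewrite -(reprK x) -(reprK y); apply/eqmodP/asboolP => W f; apply: h.
Qed.

Let liftE := (@tlift0, @tlift_add, @tlift_scale, @tlift_tens).

Lemma tens_addA : associative tens_add.
Proof. by move=> x y z; apply: tensorP => W f; rewrite !liftE addrA. Qed.
Lemma tens_addC : commutative tens_add.
Proof. by move=> x y; apply: tensorP => W f; rewrite !liftE addrC. Qed.
Lemma tens_add0 : left_id tens0 tens_add.
Proof. by move=> x; apply: tensorP => W f; rewrite !liftE add0r. Qed.
Lemma tens_addN : left_inverse tens0 tens_opp tens_add.
Proof. by move=> x; apply: tensorP => W f; rewrite !liftE scaleN1r addNr. Qed.

HB.instance Definition _ :=
  GRing.isZmodule.Build tensor tens_addA tens_addC tens_add0 tens_addN.

Lemma tens_scaleA a b x : tens_scale a (tens_scale b x) = tens_scale (a * b) x.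
Proof. by apply: tensorP => W f; rewrite !liftE scalerA. Qed.
Lemma tens_scale1 : left_id 1 tens_scale.
Proof. by move=> x; apply: tensorP => W f; rewrite !liftE scale1r. Qed.
Lemma tens_scaleDr : right_distributive tens_scale +%R.
Proof. by move=> a x y; apply: tensorP => W f; rewrite !liftE scalerDr. Qed.
Lemma tens_scaleDl x : {morph tens_scale^~ x : a b / a + b}.
Proof. by move=> a b; apply: tensorP => W f; rewrite !liftE scalerDl. Qed.

HB.instance Definition _ := GRing.Zmodule_isLmodule.Build K tensor
  tens_scaleA tens_scale1 tens_scaleDr tens_scaleDl.

Lemma tlift_linear (W : lmodType K) (f : {bilinear U -> V -> W}) :
  linear (tlift f).
Proof. by move=> a x y; rewrite tlift_add tlift_scale. Qed.

HB.instance Definition _ (W : lmodType K) (f : {bilinear U -> V -> W}) :=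
  GRing.isLinear.Build K tensor W _ (tlift f) (tlift_linear f).

Lemma tens_bilinear : bilinear_for *:%R *:%R tens.
Proof.
split=> [v a u u'|u a v v']; apply: tensorP => W f /=;
  by rewrite tlift_tens tlift_linear !tlift_tens ?linearPl ?linearPr.
Qed.

HB.instance Definition _ :=
  bilinear_isBilinear.Build K U V tensor _ _ tens tens_bilinear.

Lemma tensor_sum (x : tensor) :
  exists s : seq (U * V), x = \sum_(p <- s) tens p.1 p.2.
Proof.
exists (repr x); apply: tensorP => W f; rewrite linear_sum /=.
by rewrite {1}/tlift /formal_eval; apply: eq_bigr => p _; rewrite tlift_tens.
Qed.

Lemma tlift_unique (W : lmodType K) (g h : {linear tensor -> W}) :
  (forall u v, g (tens u v) = h (tens u v)) -> g =1 h.
Proof.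
move=> gh x; have [s ->] := tensor_sum x.
by rewrite !linear_sum; apply: eq_bigr => p _; apply: gh.
Qed.
End Tensor.

(** * The associative algebra [V (x) V] and its action on [V] *)

Section TensorAlgebra.
Context {K : fieldType} {V : lmodType K}.
Variable form : {biscalar V}.

Definition act_pure (u v w : V) : V := form u w *: v.

Lemma act_pure_bilinear u : bilinear_for *:%R *:%R (act_pure u).
Proof.
split=> [w a v v'|v a w w']; rewrite /act_pure /=.
  by rewrite scalerDr !scalerA mulrC.
by rewrite linearPr /= scalerDl scalerA.
Qed.

HB.instance Definition _ u :=
  bilinear_isBilinear.Build K V V V _ _ (act_pure u) (act_pure_bilinear u).

Definition act (x : tensor V V) (u : V) : V := tlift (act_pure u) x.

Lemma act_tens v w u : act (tens v w) u = form u w *: v.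
Proof. exact: tlift_tens. Qed.

Lemma act_bilinear : bilinear_for *:%R *:%R act.
Proof.
split=> [u a x y|x a u u']; first exact: tlift_linear.
rewrite /act; have [s ->] := tensor_sum x.
rewrite !linear_sum /= scaler_sumr -big_split; apply: eq_bigr => p _ /=.
by rewrite !tlift_tens /= /act_pure linearPl /= scalerDl scalerA.
Qed.

HB.instance Definition _ :=
  bilinear_isBilinear.Build K _ V V _ _ act act_bilinear.

Definition mul_pure (x : tensor V V) (v w : V) : tensor V V := tens (act x v) w.

Lemma mul_pure_bilinear x : bilinear_for *:%R *:%R (mul_pure x).
Proof.
split=> [w a v v'|v a w w']; rewrite /mul_pure ?linearPr //.
by rewrite linearPl.
Qed.

HB.instance Definition _ x :=
  bilinear_isBilinear.Build K V V _ _ _ (mul_pure x) (mul_pure_bilinear x).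

(* [x . (v (x) w) = (x . v) (x) w]; [tmul_tens] is the formula on pure
   tensors. *)
Definition tmul (x y : tensor V V) : tensor V V := tlift (mul_pure x) y.

Lemma tmul_tens v w v' w' :
  tmul (tens v w) (tens v' w') = form v' w *: tens v w'.
Proof. by rewrite /tmul tlift_tens /= /mul_pure act_tens linearZl_LR. Qed.

Lemma tmul_bilinear : bilinear_for *:%R *:%R tmul.
Proof.
split=> [y a x x'|x a y y']; last exact: tlift_linear.
rewrite /tmul; have [s ->] := tensor_sum y.
rewrite !linear_sum /= scaler_sumr -big_split; apply: eq_bigr => p _ /=.
by rewrite !tlift_tens /= /mul_pure !linearPl.
Qed.

HB.instance Definition _ :=
  bilinear_isBilinear.Build K _ _ _ _ _ tmul tmul_bilinear.

Lemma act_mul x y u : act (tmul x y) u = act x (act y u).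
Proof.
have [s ->] := tensor_sum y.
rewrite linear_sumr !linear_sumlz linear_sumr; apply: eq_bigr => p _ /=.
by rewrite /tmul tlift_tens /= /mul_pure !act_tens linearZr_LR.
Qed.

Lemma tmulA : associative tmul.
Proof.
move=> x y z; have [s ->] := tensor_sum z.
rewrite [tmul y _]linear_sumr [LHS]linear_sumr [RHS]linear_sumr.
apply: eq_bigr => p _ /=.
rewrite {2}/tmul tlift_tens /= /mul_pure [RHS]tlift_tens /= /mul_pure act_mul.
exact: tlift_tens.
Qed.

Definition bracket (x y : tensor V V) : tensor V V := tmul x y - tmul y x.
End TensorAlgebra.

(** * Linear algebra with subspaces as sets *)

Section Subspaces.
Context {K : fieldType} {M : lmodType K}.

Definition is_subspace (W : set M) : Prop :=
  W 0 /\ forall (a : K) (u v : M), W u -> W v -> W (a *: u + v).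

Definition linear_span (A : set M) : set M := smallest is_subspace A.

Definition finite_dimensional (W : set M) : Prop :=
  exists (n : nat) (u : 'I_n -> M), W = linear_span (range u).

Definition direct_sum (W W1 W2 : set M) : Prop :=
  W = [set x + y | x in W1 & y in W2] /\ W1 `&` W2 = [set 0].
End Subspaces.

Definition countably_infinite_dimensional {K : fieldType} (M : lmodType K) :
    Prop :=
  exists e : nat -> M,
    linear_span (range e) = [set: M] /\
    forall (n : nat) (c : 'I_n -> K),
      \sum_(i < n) c i *: e i = 0 -> forall i, c i = 0.

Definition nondegenerate_form {K : fieldType} {M : lmodType K}
    (form : M -> M -> K) : Prop :=
  forall u, (forall v, form u v = 0) -> u = 0.

(** * The Lie algebra [so(V)] *)

Section SO.
Context {K : fieldType} {V : lmodType K}.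
Variable form : {biscalar V}.
Implicit Types (A : set V) (t k l N : set (tensor V V)) (x : tensor V V).

Definition wedge (v w : V) : tensor V V := tens v w - tens w v.

Definition ext2 A : set (tensor V V) :=
  linear_span [set wedge v w | v in A & w in A].

Definition so : set (tensor V V) := ext2 [set: V].

Definition lie_subalgebra k : Prop :=
  is_subspace k /\ forall x y, k x -> k y -> k (bracket form x y).

Definition lie_prod k l : set (tensor V V) :=
  linear_span [set bracket form x y | x in k & y in l].

Definition ad_stable t N : Prop :=
  forall x y, t x -> N y -> N (bracket form x y).

(* Provided that [l] is stable under [ad x] for all [x] in [t], it is a
   semisimple module over these operators: stable subspaces have stable
   complements. *)
Definition ad_semisimple t l : Prop :=
  forall N, is_subspace N -> N `<=` l -> ad_stable t N ->
  exists N', [/\ is_subspace N', ad_stable t N' & direct_sum l N N'].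

(* [k] is reductive in [l]; [reductive_in k k] says that [k] is reductive. *)
Definition reductive_in k l : Prop := ad_semisimple k l.

(* A presentation of [so] as a nested union of finite-dimensional reductive
   subalgebras, each reductive in the next. *)
Definition reductive_exhaustion (g : nat -> set (tensor V V)) : Prop :=
  [/\ forall n, [/\ lie_subalgebra (g n), finite_dimensional (g n) &
                    reductive_in (g n) (g n)],
      forall n, g n `<=` g n.+1 /\ reductive_in (g n) (g n.+1) &
      \bigcup_n g n = so].

(* [x], an element of the reductive Lie algebra [k], is semisimple when the
   endomorphism [ad x] of [k] is. *)
Definition semisimple_in k x : Prop := ad_semisimple [set x] k.

Section Exhaustion.
Variable g : nat -> set (tensor V V).

Definition semisimple_elt x : Prop :=
  so x /\ forall n, g n x -> semisimple_in (g n) x.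

Definition toral t : Prop :=
  [/\ lie_subalgebra t, t `<=` so & forall x, t x -> semisimple_elt x].

Definition maximal_toral t : Prop :=
  toral t /\ forall t', toral t' -> t `<=` t' -> t' = t.
End Exhaustion.

Definition centralizer t : set (tensor V V) :=
  [set y | so y /\ forall x, t x -> bracket form x y = 0].

(* [x^i . m] is the [i]-fold action of [x] on [m] (see [act_mul]). *)
Definition gen_zero_weight_space t : set V :=
  [set m | exists2 i : nat, (0 < i)%N &
             forall x, t x -> iter i (act form x) m = 0].
End SO.

(* Main.v *)
(* An element of [so(V)] has finite rank and is semisimple iff it is
   diagonalizable on [V]: a Jordan block on [V] would give one of [ad x], by
   wedging with a vector of the infinite-dimensional kernel. A toral subalgebra is
   abelian, so by maximality [t] contains every [v /\ w] centralizing [t] with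
   [v], [w] isotropic and [<v, w> = 1].

   A weight vector [e] of nonzero weight has a dual weight vector [f] of opposite
   weight, so [e /\ f] lies in [t], which forces the weight space to be a line.
   If [y] centralizes [t], then [t] acts on the finite-dimensional range of [y]
   with a basis of weight vectors; as long as this range contains such an [e],
   subtracting from [y] the multiple of [e /\ f] that agrees with [y] on [e]
   lowers the rank. In the end the range lies in [V0], that is, [y] is in
   [t + ext2 V0].

   Finally [V0] contains no hyperbolic plane, so the form has rank at most one on
   [V0]. Hence a product of two elements of [ext2 V0] kills [V0], and the
   commutator of two such elements is central. *)
Require Import Defs.
From HB Require Import structures.
From mathcomp Require Import all_boot all_order all_algebra.
From mathcomp Require Import boolp classical_sets reals complex.

Set Implicit Arguments.
Unset Strict Implicit.
Unset Printing Implicit Defensive.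

Import GRing.Theory Num.Theory.

Local Open Scope classical_set_scope.
Local Open Scope ring_scope.

(** * Subspaces and dimension *)

Section Subspaces.
Context {K : fieldType} {M : lmodType K}.
Implicit Types (W A : set M) (u v : M).

Lemma subspaceD W u v : is_subspace W -> W u -> W v -> W (u + v).
Proof. by move=> [_ WP] Wu Wv; rewrite -[u]scale1r; apply: WP. Qed.

Lemma subspaceZ W a u : is_subspace W -> W u -> W (a *: u).
Proof. by move=> [W0 WP] Wu; rewrite -[a *: u]addr0; apply: WP. Qed.

Lemma subspaceB W u v : is_subspace W -> W u -> W v -> W (u - v).
Proof.
move=> sW Wu Wv; apply: subspaceD => //.
by rewrite -scaleN1r; apply: subspaceZ.
Qed.

Lemma subspace_sum W (I : Type) (r : seq I) (F : I -> M) :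
  is_subspace W -> (forall i, W (F i)) -> W (\sum_(i <- r) F i).
Proof.
move=> sW WF; elim/big_ind: _ => //; first by case: sW.
by move=> u v; apply: subspaceD.
Qed.

Lemma linear_span_subspace A : is_subspace (linear_span A).
Proof.
split=> [W [[]]//|a u v Au Av W WA]; have [[_ WP] _] := WA.
by apply: WP; [apply: Au|apply: Av].
Qed.

Lemma subset_linear_span A : A `<=` linear_span A.
Proof. exact: sub_gen_smallest. Qed.

Lemma linear_span_min A W : is_subspace W -> A `<=` W -> linear_span A `<=` W.
Proof. exact: smallest_sub. Qed.

Lemma linear_span_mono A B : A `<=` B -> linear_span A `<=` linear_span B.
Proof.
move=> AB; apply: linear_span_min; first exact: linear_span_subspace.
by move=> u /AB; apply: subset_linear_span.
Qed.

Lemma subspace0 : is_subspace [set (0 : M)].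
Proof. by split=> // a u v -> ->; rewrite scaler0 addr0. Qed.

Lemma subspaceT : is_subspace [set: M]. Proof. by []. Qed.

Lemma subspaceI W1 W2 :
  is_subspace W1 -> is_subspace W2 -> is_subspace (W1 `&` W2).
Proof.
move=> [W10 W1P] [W20 W2P]; split=> // a u v [? ?] [? ?].
by split; [apply: W1P|apply: W2P].
Qed.

Lemma subspace_preimage (M' : lmodType K) (f : {linear M -> M'}) (W : set M') :
  is_subspace W -> is_subspace (f @^-1` W).
Proof.
move=> [W0 WP]; split=> [|a u v Wu Wv] /=; first by rewrite linear0.
by rewrite linearP; apply: WP.
Qed.

Lemma subspace_image (M' : lmodType K) (f : {linear M -> M'}) W :
  is_subspace W -> is_subspace (f @` W).
Proof.
move=> [W0 WP]; split=> [|a _ _ [u Wu <-] [v Wv <-]].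
  by exists 0 => //; rewrite linear0.
by exists (a *: u + v); [apply: WP|rewrite linearP].
Qed.

Lemma linear_spanU_line W u v : is_subspace W ->
  linear_span (W `|` [set u]) v -> exists2 w, W w & exists c, v = w + c *: u.
Proof.
move=> sW; apply: (@linear_span_min _ [set v |
  exists2 w, W w & exists c, v = w + c *: u]).
  split=> [|a _ _ [w Ww [c ->]] [w' Ww' [c' ->]]].
    by exists 0; [case: sW|exists 0; rewrite scale0r addr0].
  exists (a *: w + w'); first by case: sW => _; apply.
  by exists (a * c + c'); rewrite scalerDr scalerDl scalerA addrACA.
move=> x [Wx|->]; first by exists x => //; exists 0; rewrite scale0r addr0.
by exists 0; [case: sW|exists 1; rewrite scale1r add0r].
Qed.

Lemma linear_span_range n (e : 'I_n -> M) v :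
  linear_span (range e) v -> exists c : 'I_n -> K, v = \sum_i c i *: e i.
Proof.
apply: (@linear_span_min _ [set v |
  exists c : 'I_n -> K, v = \sum_i c i *: e i]).
  split=> [|a _ _ [c ->] [d ->]].
    by exists (fun=> 0); rewrite big1 // => i _; rewrite scale0r.
  exists (fun i => a * c i + d i); rewrite scaler_sumr -big_split.
  by apply: eq_bigr => i _ /=; rewrite scalerDl scalerA.
move=> _ [i _ <-]; exists (fun j => (j == i)%:R).
rewrite (bigD1 i) //= eqxx scale1r big1 ?addr0 // => j /negPf ->.
by rewrite scale0r.
Qed.

(** A bound by linear dependence requires no basis and passes to subsets at once; it serves as the
    measure of the inductions on dimension. *)
Definition dim_le W n := forall w : 'I_n.+1 -> M, (forall i, W (w i)) ->
  exists2 c : 'rV[K]_n.+1, c != 0 & \sum_i c 0 i *: w i = 0.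

Lemma exists_left_kernel n m (A : 'M[K]_(m, n)) :
  (n < m)%N -> exists2 c : 'rV[K]_m, c != 0 & c *m A = 0.
Proof.
move=> nm; have /rowV0Pn[c /sub_kermxP cA c0] : kermx A != 0.
  rewrite kermx_eq0 -row_leq_rank -ltnNge.
  by apply: leq_ltn_trans nm; exact: rank_leq_col.
by exists c.
Qed.

(** The coefficient matrix of [n.+1] vectors has more rows than columns, hence a nonzero left kernel
    vector. *)
Lemma dim_le_span n (e : 'I_n -> M) W :
  (forall w, W w -> exists c : 'I_n -> K, w = \sum_i c i *: e i) ->
  dim_le W n.
Proof.
move=> We w Ww; have /choice[c wE] : forall i, exists c, w i =
  \sum_(j < n) c j *: e j by move=> i; apply: We.
have [d d0 dA] := exists_left_kernel (\matrix_(i < n.+1, j < n) c i j) (ltnSn n).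
exists d => //; under eq_bigr do rewrite wE scaler_sumr.
rewrite exchange_big big1 // => j _ /=.
under eq_bigr do rewrite scalerA.
rewrite -scaler_suml; move/rowP: dA => /(_ j); rewrite !mxE.
by under eq_bigr do rewrite mxE; move=> ->; rewrite scale0r.
Qed.

Lemma finite_dimensional_dim_le W :
  finite_dimensional W -> exists n, dim_le W n.
Proof.
move=> [n [e ->]]; exists n; apply: (@dim_le_span _ e) => w.
exact: linear_span_range.
Qed.

Lemma dim_le0 W w : dim_le W 0 -> W w -> w = 0.
Proof.
move=> W0 Ww; have [c c0] := W0 (fun=> w) (fun=> Ww).
rewrite big_ord1 => /eqP; rewrite scaler_eq0 => /orP[/eqP c00|/eqP//].
by case/eqP: c0; apply/rowP => i; rewrite ord1 c00 mxE.
Qed.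

(** Adjoin [e] to [n.+1] vectors of [W']: in a dependence relation the coefficient of [e] vanishes,
    because [e] is not in [W']. *)
Lemma dim_le_proper (W W' : set M) n e :
  is_subspace W' -> W' `<=` W -> W e -> ~ W' e ->
  dim_le W n.+1 -> dim_le W' n.
Proof.
move=> sW' W'W We W'e Wn w W'w.
pose w' (i : 'I_n.+2) := if unlift ord0 i is Some j then w j else e.
have [i|c c0] := Wn w'; first by rewrite /w'; case: unlift => // j; apply: W'W.
rewrite big_ord_recl {1}/w' unlift_none.
under eq_bigr do rewrite /w' liftK.
move=> ce; have c00 : c 0 0 = 0.
  apply/eqP/negP => /negP c00; apply: W'e.
  suff -> : e = - (c 0 0)^-1 *: \sum_(i < n.+1) c 0 (lift ord0 i) *: w i.
    by apply: subspaceZ => //; apply: subspace_sum => // i; apply: subspaceZ.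
  rewrite -[e]scale1r -(mulVf c00) -scalerA.
  by move/eqP: ce; rewrite addr_eq0 => /eqP ->; rewrite scaleNr scalerN.
exists (\row_i c 0 (lift ord0 i)); last first.
  move: ce; rewrite c00 scale0r add0r => ce; rewrite -[RHS]ce.
  by apply: eq_bigr => i _; rewrite mxE.
apply: contra_neq c0 => /rowP c'0; apply/rowP => i; rewrite mxE.
by case: (unliftP ord0 i) => [j ->|->//]; move: (c'0 j); rewrite !mxE.
Qed.
End Subspaces.

(** * Eigenvectors of locally finite maps *)

Section Eigenvectors.
Context {K : fieldType} {M : lmodType K}.
Implicit Types (W : set M) (u v : M).

(** Zero counts as an eigenvector. Diagonalizability of [f] is expressed by saying that every vector
    lies in [linear_span (eigvec f)]. *)
Definition eigvec (f : M -> M) : set M := [set v | exists a, f v = a *: v].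

Definition stable (f : M -> M) W := forall v, W v -> W (f v).

(** The product of the operators [f - a] for [a] in [s], that is, a split monic polynomial in [f]
    with roots listed with multiplicity. *)
Fixpoint pencil (f : M -> M) (s : seq K) (v : M) : M :=
  if s is a :: s' then f (pencil f s' v) - a *: pencil f s' v else v.

Variable f : {linear M -> M}.

Lemma pencil_linear s : linear (pencil f s).
Proof.
elim: s => [//|b s IHs] a u v /=.
by rewrite !IHs linearP scalerDr scalerBr opprD addrACA !scalerA [b * a]mulrC.
Qed.

HB.instance Definition _ s :=
  GRing.isLinear.Build K M M _ (pencil f s) (pencil_linear s).

Lemma pencil_stable W s v :
  is_subspace W -> stable f W -> W v -> W (pencil f s v).
Proof.
move=> sW fW Wv; elim: s => //= a s IHs.
by apply: subspaceB => //; [apply: fW|apply: subspaceZ].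
Qed.

Lemma pencil_eigen s a v :
  f v = a *: v -> pencil f s v = (\prod_(b <- s) (a - b)) *: v.
Proof.
move=> fv; elim: s => [|b s IHs] /=; first by rewrite big_nil scale1r.
by rewrite IHs linearZ /= fv !scalerA -scalerBl big_cons mulrC -mulrBl mulrC.
Qed.

Lemma pencilC s v : pencil f s (f v) = f (pencil f s v).
Proof. by elim: s => //= a s ->; rewrite [RHS]linearB [f (_ *: _)]linearZ. Qed.

(* Lagrange interpolation, one eigenvalue at a time. *)
Lemma pencil_uniq_eigvec W s v : is_subspace W -> stable f W -> W v ->
  uniq s -> pencil f s v = 0 -> linear_span (eigvec f `&` W) v.
Proof.
move=> sW fW; elim: s v => [|a s IHs] v Wv /=.
  by move=> _ ->; case: (linear_span_subspace (eigvec f `&` W)).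
move=> /andP[as_ us] /eqP; rewrite subr_eq0 => /eqP fu.
set u := pencil f s v in fu; set c := \prod_(b <- s) (a - b).
have Wu : W u by apply: pencil_stable.
have c0 : c != 0.
  rewrite prodf_seq_neq0; apply/allP => b bs /=; rewrite subr_eq0.
  by apply: contraNneq as_ => ->.
(* [u] is an eigenvector for [a], on which [pencil f s] acts as the scalar [c]; hence [pencil f s]
   kills the remainder. *)
have -> : v = c^-1 *: u + (v - c^-1 *: u) by rewrite addrC subrK.
have sE := linear_span_subspace (eigvec f `&` W).
apply: (subspaceD sE).
  apply: (subspaceZ _ sE).
  by apply: subset_linear_span; split => //; exists a.
apply: IHs => //.
  by apply: subspaceB => //; apply: subspaceZ.
by rewrite linearB linearZ /= (pencil_eigen _ fu) scalerA mulVf // scale1r subrr.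
Qed.

(** Asking for all lists that contain [s0] makes the property stable under sums: the lists of two
    vectors are concatenated. *)
Lemma eigvec_pencil v : linear_span (eigvec f) v ->
  exists s0 : seq K, forall s, {subset s0 <= s} -> pencil f s v = 0.
Proof.
apply: (@linear_span_min _ _ _ [set v | exists s0 : seq K,
  forall s, {subset s0 <= s} -> pencil f s v = 0]).
  split=> [|a u w [s1 us1] [s2 ws2]]; first by exists nil => s _; rewrite linear0.
  exists (s1 ++ s2) => s ss; rewrite pencil_linear us1 ?ws2 ?scaler0 ?addr0 //.
    by move=> x xs; apply: ss; rewrite mem_cat xs orbT.
  by move=> x xs; apply: ss; rewrite mem_cat xs.
move=> u [a fu]; exists [:: a] => s as_; rewrite (pencil_eigen _ fu).
suff /eqP -> : \prod_(b <- s) (a - b) == 0 by rewrite scale0r.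
rewrite prodf_seq_eq0; apply/hasP; exists a; last by rewrite /= subrr.
by apply: as_; rewrite inE.
Qed.

(** A list that kills [v] can be made duplicate-free by [eigvec_pencil]; interpolation at distinct
    roots then stays inside [W]. *)
Lemma eigvec_stable W v : is_subspace W -> stable f W -> W v ->
  linear_span (eigvec f) v -> linear_span (eigvec f `&` W) v.
Proof.
move=> sW fW Wv /eigvec_pencil[s0 s0P].
apply: (@pencil_uniq_eigvec _ (undup s0)) => //; first exact: undup_uniq.
by apply: s0P => x; rewrite mem_undup.
Qed.

Lemma pencil2_subspace a : is_subspace [set v | pencil f [:: a; a] v = 0].
Proof. exact: (subspace_preimage (pencil f [:: a; a]) subspace0). Qed.

(** The kernel of [(f - a)^2] is stable, so [v] is a sum of eigenvectors inside it; a nonzero one of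
    eigenvalue [b] satisfies [(b - a)^2 = 0]. *)
Lemma eigvec_no_jordan a v : linear_span (eigvec f) v ->
  pencil f [:: a; a] v = 0 -> f v = a *: v.
Proof.
move=> fv av.
have /eigvec_stable : stable f [set v | pencil f [:: a; a] v = 0].
  by move=> u /= u0; rewrite -/(pencil f [:: a; a] _) pencilC /= u0 linear0.
move=> /(_ v (pencil2_subspace a) av fv) {}fv.
apply/eqP; rewrite -subr_eq0; apply/eqP.
suff : linear_span (eigvec f `&` [set v | pencil f [:: a; a] v = 0]) `<=`
  [set v | pencil f [:: a] v = 0] by apply.
apply: linear_span_min.
  exact: (subspace_preimage (pencil f [:: a]) subspace0).
move=> u [[b fu]] /=; rewrite -/(pencil f [:: a; a] u) -/(pencil f [:: a] u).
rewrite !(pencil_eigen _ fu) !big_cons !big_nil mulr1 => /eqP.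
by rewrite scaler_eq0 mulf_eq0 orbb -scaler_eq0 => /eqP.
Qed.

(** A converse to [eigvec_no_jordan]. By induction [f v - a v] is a sum of eigenvectors; subtracting
    a suitable such sum from [v] leaves a vector in the kernel of [(f - a)^2]. *)
Lemma pencil_no_jordan_eigvec W s v : is_subspace W -> stable f W ->
  (forall a u, W u -> pencil f [:: a; a] u = 0 -> f u = a *: u) ->
  W v -> pencil f s v = 0 -> linear_span (eigvec f `&` W) v.
Proof.
move=> sW fW WJ; have sE := linear_span_subspace (eigvec f `&` W).
elim: s v => [v _ /= ->|a s IHs v Wv v0]; first by case: sE.
have Wv' : W (f v - a *: v).
  by apply: subspaceB => //; [apply: fW|apply: subspaceZ].
have {v0} /IHs : pencil f s (f v - a *: v) = 0.
  by rewrite linearB linearZ /= pencilC.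
move=> /(_ Wv') fv.
(* Components of eigenvalue [b != a] are divided by [b - a]; a component of eigenvalue [a] is left
   over, and one more factor [f - a] kills it. *)
have [w Ew wv] : exists2 w, linear_span (eigvec f `&` W) w &
    pencil f [:: a] (f v - a *: v - (f w - a *: w)) = 0.
  move: fv; apply: (@linear_span_min _ _ _ [set u | exists2 w,
    linear_span (eigvec f `&` W) w & pencil f [:: a] (u - (f w - a *: w)) = 0]).
    split=> [|b u1 u2 [w1 Ew1 uw1] [w2 Ew2 uw2]].
      by exists 0; [case: sE|rewrite linear0 scaler0 subrr subr0 linear0].
    exists (b *: w1 + w2); first by case: sE => _; apply.
    have /= -> := pencil_linear [:: a] b w1 w2; rewrite opprD addrACA -scalerBr.
    have := pencil_linear [:: a] b (u1 - (f w1 - a *: w1)) (u2 - (f w2 - a *: w2)).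
    by rewrite uw1 uw2 scaler0 addr0.
  move=> u [[b fu] Wu]; have [ab|ab] := eqVneq b a.
    by exists 0; [case: sE|rewrite linear0 scaler0 !subr0 /= fu ab subrr].
  exists ((b - a)^-1 *: u).
    by apply: (subspaceZ _ sE); apply: subset_linear_span; split => //; exists b.
  have -> : f ((b - a)^-1 *: u) - a *: ((b - a)^-1 *: u) = u.
    rewrite linearZ /= fu !scalerA [a * _]mulrC -scalerBl -mulrBr.
    by rewrite mulVf ?subr_eq0 // scale1r.
  by rewrite subrr linear0.
have Ww : W w by apply: linear_span_min Ew => // u [].
rewrite -[v](subrK w); apply: (subspaceD sE) => //.
have Wvw : W (v - w) by apply: subspaceB.
apply: subset_linear_span; split => //; exists a; apply: WJ => //.
suff <- : pencil f [:: a] (f v - a *: v - (f w - a *: w)) =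
  pencil f [:: a; a] (v - w) by [].
by rewrite -/(pencil f [:: a] v) -/(pencil f [:: a] w) -linearB.
Qed.

(** The last nonzero vector met while the factors are applied one by one is an eigenvector. *)
Lemma pencil_exists_eigvec W s v : is_subspace W -> stable f W ->
  W v -> v != 0 -> pencil f s v = 0 -> exists2 u, u != 0 & (eigvec f `&` W) u.
Proof.
move=> sW fW Wv v0; elim: s => [/= /eqP|a s IHs /= /eqP]; first by rewrite (negPf v0).
have [/IHs //|su0] := eqVneq (pencil f s v) 0.
rewrite subr_eq0 => /eqP fu; exists (pencil f s v) => //.
by split; [exists a|apply: pencil_stable].
Qed.

(* The complement is built by adding, one by one, the eigenvectors of [e] that
   are not yet in the sum. *)
Lemma eigvec_seq_complement N (e : seq M) :
  is_subspace N -> stable f N -> (forall v, v \in e -> eigvec f v) ->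
  exists N', [/\ is_subspace N', stable f N', N' `&` N = [set 0],
    N' `<=` linear_span [set v | v \in e] &
    [set v | v \in e] `<=` [set x + y | x in N & y in N']].
Proof.
move=> sN fN; elim: e => [_|v e IHe ev].
  exists [set 0]; split=> //; first exact: subspace0.
  - by move=> _ ->; rewrite /= linear0.
  - by apply/seteqP; split=> [x []//|x ->]; split=> //; case: sN.
  - by move=> _ ->; exact: (proj1 (linear_span_subspace _)).
have [|N' [sN' fN' NN' N'e eN']] := IHe.
  by move=> u ue; apply: ev; rewrite inE ue orbT.
have N'e' : N' `<=` linear_span [set u | u \in v :: e].
  apply: subset_trans N'e _; apply: linear_span_mono => u /= ue.
  by rewrite inE ue orbT.
have [vN|vN] := pselect ([set x + y | x in N & y in N'] v).
  exists N'; split=> // u /=; rewrite inE => /orP[/eqP -> //|].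
  exact: eN'.
exists (linear_span (N' `|` [set v])); split.
- exact: linear_span_subspace.
- move=> u /(linear_spanU_line sN')[w N'w [c ->]].
  have sS := linear_span_subspace (N' `|` [set v]).
  rewrite linearD linearZ /=; apply: (subspaceD sS).
    by apply: subset_linear_span; left; apply: fN'.
  apply: (subspaceZ _ sS); have [|a ->] := ev v; first by rewrite mem_head.
  by apply: (subspaceZ _ sS); apply: subset_linear_span; right.
- apply/seteqP; split=> [u [/(linear_spanU_line sN')[w N'w [c ->]] Nu]|u ->].
    have [c0|c0] := eqVneq c 0.
      by rewrite -NN'; split=> //; rewrite c0 scale0r addr0 in Nu *.
    case: vN; exists (c^-1 *: (w + c *: v)); first exact: subspaceZ.
    exists (- c^-1 *: w); first exact: subspaceZ.
    by rewrite scalerDr scalerA mulVf // scale1r scaleNr addrAC subrr add0r.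
  by split; [case: (linear_span_subspace (N' `|` [set v]))|case: sN].
- apply: linear_span_min; first exact: linear_span_subspace.
  move=> u [/N'e'//|->]; apply: subset_linear_span => /=; exact: mem_head.
- move=> u /=; rewrite inE => /orP[/eqP ->|/eN'[x Nx [y N'y <-]]].
    exists 0; first by case: sN.
    by exists v; [apply: subset_linear_span; right|rewrite add0r].
  exists x => //; exists y => //; apply: subset_linear_span; by left.
Qed.

End Eigenvectors.

(** [g] preserves each eigenspace of [f], so common eigenvectors span it, and these are eigenvectors
    of [h]. *)
Lemma eigvec_comm (K : fieldType) (M : lmodType K) (f g h : {linear M -> M}) c v :
  (forall u, f (g u) = g (f u)) -> (forall u, h u = f u + c *: g u) ->
  (forall u, linear_span (eigvec f) u) -> (forall u, linear_span (eigvec g) u) ->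
  linear_span (eigvec h) v.
Proof.
move=> fg hE fE gE; move: (fE v); apply: linear_span_min.
  exact: linear_span_subspace.
move=> u [a fu].
have sW : is_subspace [set w | f w = a *: w].
  split=> [|b x y /= fx fy]; first by rewrite /= linear0 scaler0.
  by rewrite linearP fx fy scalerDr !scalerA mulrC.
have gW : stable g [set w | f w = a *: w].
  by move=> w /= fw; rewrite fg fw linearZ.
have := eigvec_stable sW gW fu (gE u); apply: linear_span_min.
  exact: linear_span_subspace.
move=> w [[b gw] fw]; apply: subset_linear_span; exists (a + c * b).
by rewrite hE fw gw scalerA -scalerDl.
Qed.

(** * Locally finite maps over an algebraically closed field *)

Section LocallyFinite.
Context {K : closedFieldType} {M : lmodType K}.
Variable f : {linear M -> M}.

(** The link between [pencil] and polynomials, through which factorization over [K] becomes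
    available. *)
Lemma sum_coef_prod_XsubC (s : seq K) v :
  \sum_(i < (size s).+1) (\prod_(a <- s) ('X - a%:P))`_i *: iter i f v =
  pencil f s v.
Proof.
elim: s => [|a s IHs] /=; first by rewrite big_nil big_ord1 coefC scale1r.
rewrite -IHs big_cons mulrBl; set q := \prod_(b <- s) _.
under eq_bigr do rewrite coefB coefXM coefCM scalerBl.
rewrite sumrB; congr (_ - _).
  rewrite big_ord_recl /= scale0r add0r linear_sum.
  by apply: eq_bigr => i _; rewrite linearZ.
(* [q] has degree [size s], so its coefficient at the last index [(size s).+1] is zero. *)
rewrite big_ord_recr /= [X in _ + X](_ : _ = 0) ?addr0 ?scaler_sumr.
  by apply: eq_bigr => i _; rewrite scalerA.
by rewrite nth_default ?mulr0 ?scale0r // size_prod_XsubC.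
Qed.

(** The [n.+1] iterates [v], [f v], ... lie in [W], so they are dependent; the relation is a nonzero
    polynomial in [f] that kills [v] and splits into linear factors. *)
Lemma pencil_annihilates W n v :
  dim_le W n -> stable f W -> W v -> exists s, pencil f s v = 0.
Proof.
move=> Wn fW Wv; have [i|c c0 cv] := Wn (fun i => iter i f v).
  by elim: (nat_of_ord i) => //= k; apply: fW.
have [s sE] := closed_field_poly_normal (rVpoly c).
have p0 : rVpoly c != 0.
  apply: contraNneq c0 => /(congr1 (poly_rV (d := n.+1))).
  by rewrite rVpolyK linear0 => ->.
have size_s : (size s < n.+1)%N.
  have := size_poly n.+1 (fun k => if insub k is Some i then c 0 i else 0).
  rewrite -/(rVpoly c) sE size_scale ?lead_coef_eq0 //.
  by rewrite size_prod_XsubC.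
exists s; rewrite -sum_coef_prod_XsubC.
have : lead_coef (rVpoly c) *:
    \sum_(i < n.+1) (\prod_(a <- s) ('X - a%:P))`_i *: iter i f v = 0.
  rewrite scaler_sumr -[RHS]cv; apply: eq_bigr => i _.
  by rewrite scalerA -coefZ -sE coef_rVpoly_ord.
move/eqP; rewrite scaler_eq0 lead_coef_eq0 (negPf p0) => /eqP s0.
(* The relation has [n.+1] terms; those beyond the degree have coefficient zero. *)
rewrite -[RHS]s0 -(subnKC size_s) big_split_ord /=
  [X in _ = _ + X]big1 ?addr0 // => i _.
by rewrite nth_default ?scale0r // size_prod_XsubC leq_addr.
Qed.

(* A stable complement of the span of the eigenvectors contains no eigenvector,
   hence is zero. *)
Lemma complement_eigvec W n :
  is_subspace W -> dim_le W n -> stable f W ->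
  (forall N, is_subspace N -> N `<=` W -> stable f N ->
     exists N', [/\ is_subspace N', stable f N' & direct_sum W N N']) ->
  W `<=` linear_span (eigvec f `&` W).
Proof.
move=> sW Wn fW Wss; have sE := linear_span_subspace (eigvec f `&` W).
have EW : linear_span (eigvec f `&` W) `<=` W.
  by apply: linear_span_min => // u [].
have [|N' [sN' fN' [WE EN']]] := Wss _ sE EW.
  apply: (linear_span_min (subspace_preimage f sE)) => u [[a fu] Wu] /=.
  rewrite fu; apply: (subspaceZ _ sE); apply: subset_linear_span.
  by split => //; exists a.
have N'W : N' `<=` W.
  by rewrite WE => u N'u; exists 0; [case: sE|exists u; rewrite ?add0r].
suff N'0 : N' `<=` [set 0].
  by move=> v; rewrite {1}WE => -[x Ex [y /N'0 -> <-]]; rewrite addr0.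
move=> v N'v; apply/eqP/negP => /negP v0.
have [s sv] := pencil_annihilates Wn fW (N'W _ N'v).
have [u u0 [fu N'u]] := pencil_exists_eigvec sN' fN' N'v v0 sv.
suff : [set 0] u by move/eqP; rewrite (negPf u0).
by rewrite -EN'; split => //; apply: subset_linear_span; split => //; apply: N'W.
Qed.

End LocallyFinite.

(** * Simultaneous diagonalization of commuting families *)

Section JointEigenvectors.
Context {K : closedFieldType} {M : lmodType K} {I : Type}.
Variables (P : set I) (F : I -> {linear M -> M}).
Hypothesis F_comm :
  forall i j, P i -> P j -> forall u, F i (F j u) = F j (F i u).
Hypothesis F_eigvec : forall i, P i -> forall u, linear_span (eigvec (F i)) u.

Definition joint_eigvec (alpha : I -> K) : set M :=
  [set v | forall i, P i -> F i v = alpha i *: v].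

(** If some [F i] has two eigenvalues on [W], its eigenspaces in [W] are proper and stable under the
    family, and induction applies to them. Otherwise each [F i] acts on [W] as a scalar. *)
Lemma joint_eigvec_span W n : is_subspace W -> dim_le W n ->
  (forall i, P i -> stable (F i) W) ->
  W `<=` linear_span [set v | W v /\ exists alpha, joint_eigvec alpha v].
Proof.
elim: n W => [|n IHn] W sW Wn FW v Wv.
  by rewrite (dim_le0 Wn Wv); exact: (proj1 (linear_span_subspace _)).
have sE := linear_span_subspace [set v | W v /\ exists alpha, joint_eigvec alpha v].
pose eigW i a := [set u | F i u = a *: u] `&` W.
have seigW i a : is_subspace (eigW i a).
  apply: subspaceI => //; split=> [|b x y /= fx fy]; first by rewrite /= linear0 scaler0.
  by rewrite linearP fx fy scalerDr !scalerA mulrC.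
have [[i [a [b [x [y [Pi ab [x0 Wx] [y0 Wy]]]]]]]|allscal] := pselect
    (exists i a b x y, [/\ P i, a != b, x != 0 /\ eigW i a x & y != 0 /\ eigW i b y]).
  have := eigvec_stable sW (FW _ Pi) Wv (F_eigvec Pi v).
  apply: linear_span_min => // u [[c Fu] Wu].
  (* An eigenvector for an eigenvalue other than [c] witnesses that the eigenspace for [c] is
     proper. *)
  have [e We [d [dc e0 Fe]]] : exists2 e, W e &
      exists d, [/\ d != c, e != 0 & F i e = d *: e].
    have [ac|ac] := eqVneq a c; last by exists x; [case: Wx|exists a; split=> //; case: Wx].
    by exists y; [case: Wy|exists b; split=> //; [rewrite -ac eq_sym|case: Wy]].
  have cn : dim_le (eigW i c) n.
    apply: (dim_le_proper (seigW i c) _ We) Wn => [w []//|[]].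
    rewrite /= Fe => /eqP; rewrite -subr_eq0 -scalerBl scaler_eq0 subr_eq0.
    by rewrite (negPf dc) (negPf e0).
  have /(_ u (conj Fu Wu)) : eigW i c `<=`
      linear_span [set v | eigW i c v /\ exists alpha, joint_eigvec alpha v].
    apply: IHn => // j Pj w [Fw Ww]; split; last exact: FW.
    by rewrite /= F_comm // Fw linearZ.
  by apply: linear_span_mono => w [[]].
have [->|v0] := eqVneq v 0; first by case: sE.
apply: subset_linear_span; split => //.
suff /choice[alpha alphaP] : forall i, exists a, P i -> F i v = a *: v.
  by exists alpha => i Pi; apply: alphaP.
(* Off [P] the function [alpha] takes the default value 0. *)
move=> i; have [Pi|nPi] := pselect (P i); last by exists 0.
have [|noeig] := pselect (exists a x, x != 0 /\ eigW i a x).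
  move=> [a [x [x0 Wx]]]; exists a => _.
  suff : linear_span (eigvec (F i) `&` W) `<=` eigW i a.
    by move=> /(_ v (eigvec_stable sW (FW _ Pi) Wv (F_eigvec Pi v)))[].
  apply: linear_span_min => // u [[b Fu] Wu]; split => //=.
  have [->|u0] := eqVneq u 0; first by rewrite linear0 scaler0.
  have [->//|ab] := eqVneq a b.
  by case: allscal; exists i, a, b, x, u.
(* This case is absurd, as the nonzero [v] is a sum of eigenvectors of [F i] in [W]; the witness 0
   is a placeholder. *)
exists 0 => _; case: noeig.
have : linear_span (eigvec (F i) `&` W) v.
  exact: (eigvec_stable sW (FW _ Pi) Wv (F_eigvec Pi v)).
move=> Ev; apply: contrapT => noeig.
suff : linear_span (eigvec (F i) `&` W) `<=` [set 0].
  by move=> /(_ v Ev)/eqP; rewrite (negPf v0).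
apply: linear_span_min; first exact: subspace0.
move=> u [[b Fu] Wu] /=; apply/eqP/negP => /negP u0.
by apply: noeig; exists b, u.
Qed.

End JointEigenvectors.

(** * The Lie algebra [so(V)] *)

Section OrthogonalAlgebra.
Context {K : fieldType} {V : lmodType K}.
Variable form : {biscalar V}.
Implicit Types (x y z : tensor V V) (u v w : V) (N A : set V).

Local Notation act := (act form).
Local Notation tmul := (tmul form).
Local Notation bracket := (bracket form).

Lemma formDr u v w : form u (v + w) = form u v + form u w.
Proof. exact: linearDr. Qed.
Lemma formDl u v w : form (u + v) w = form u w + form v w.
Proof. exact: linearDl. Qed.
Lemma formBr u v w : form u (v - w) = form u v - form u w.
Proof. exact: linearBr. Qed.
Lemma formBl u v w : form (u - v) w = form u w - form v w.
Proof. exact: linearBl. Qed.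
Lemma formZr a u v : form u (a *: v) = a * form u v.
Proof. exact: linearZr_LR. Qed.
Lemma formZl a u v : form (a *: u) v = a * form u v.
Proof. exact: linearZl_LR. Qed.
Lemma form0l u : form 0 u = 0. Proof. exact: linear0l. Qed.
Lemma form0r u : form u 0 = 0. Proof. exact: linear0r. Qed.

Lemma orthogonal_subspace v : is_subspace [set u | form v u = 0].
Proof.
split=> [|a u w /= vu vw]; first exact: form0r.
by rewrite formDr formZr vu vw mulr0 addr0.
Qed.

Lemma bracket_bilinear : bilinear_for *:%R *:%R bracket.
Proof.
by split=> z a x y; rewrite /Defs.bracket linearPl linearPr /= scalerBr opprD addrACA.
Qed.

HB.instance Definition _ := bilinear_isBilinear.Build K _ _ _ _ _
  bracket bracket_bilinear.

HB.instance Definition _ x := GRing.isLinear.Build K V V _ (act x)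
  (fun a => linearPr act x a).

HB.instance Definition _ x := GRing.isLinear.Build K _ _ _ (bracket x)
  (fun a => linearPr bracket x a).

Lemma bracketC x y : bracket y x = - bracket x y.
Proof. by rewrite /Defs.bracket opprB. Qed.

Lemma bracketxx x : bracket x x = 0. Proof. exact: subrr. Qed.

Lemma act_bracket x y u : act (bracket x y) u = act x (act y u) - act y (act x u).
Proof. by rewrite /Defs.bracket linearBl /= !act_mul. Qed.

Lemma bracket_comm x y : bracket x y = 0 -> forall u, act x (act y u) = act y (act x u).
Proof.
move=> xy u; apply/eqP; rewrite -subr_eq0 -act_bracket xy.
by rewrite linear0l.
Qed.

Lemma jacobi x y z :
  bracket x (bracket y z) = bracket (bracket x y) z + bracket y (bracket x z).
Proof.
rewrite /Defs.bracket !linearBr !linearBl /= !tmulA !opprB [RHS]addrACA !subrKA.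
by rewrite [LHS]addrACA [RHS]addrACA [- tmul (tmul y z) x - _]addrC.
Qed.

Lemma act_wedge u v w : act (wedge u v) w = form w v *: u - form w u *: v.
Proof. by rewrite /wedge linearBl /= !act_tens. Qed.

Lemma wedge_bilinear : bilinear_for *:%R *:%R (@wedge K V).
Proof.
by split=> w a u v; rewrite /wedge linearPl linearPr /= scalerBr opprD addrACA.
Qed.

HB.instance Definition _ := bilinear_isBilinear.Build K _ _ _ _ _
  (@wedge K V) wedge_bilinear.

HB.instance Definition _ v := GRing.isLinear.Build K _ _ _ (wedge v)
  (fun a => linearPr (@wedge K V) v a).

Lemma ext2_subspace N : is_subspace (ext2 N). Proof. exact: linear_span_subspace. Qed.

Lemma wedge_ext2 N u v : N u -> N v -> ext2 N (wedge u v).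
Proof. by move=> Nu Nv; apply: subset_linear_span; exists u => //; exists v. Qed.

Lemma wedge_so u v : so (wedge u v). Proof. exact: wedge_ext2. Qed.

(** Together with [so_range_ext2], this recognizes [ext2 N] inside [so] by the range of the
    action. *)
Lemma ext2_range N x u : is_subspace N -> ext2 N x -> N (act x u).
Proof.
move=> sN; apply: (@linear_span_min _ _ _ [set x | N (act x u)]).
  split=> [|a y z Ny Nz] /=; first by rewrite linear0l; case: sN.
  by rewrite linearPl; case: sN => _; apply.
move=> _ [v Nv [w Nw <-]] /=; rewrite act_wedge.
by apply: subspaceB => //; apply: subspaceZ.
Qed.

Lemma range_act_subspace x : is_subspace (range (act x)).
Proof. exact: (subspace_image (act x) subspaceT). Qed.

Lemma act_sum (s : seq (V * V)) u :
  act (\sum_(p <- s) tens p.1 p.2) u = \sum_(p <- s) form u p.2 *: p.1.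
Proof. by rewrite linear_sumlz; apply: eq_bigr => p _; apply: act_tens. Qed.

(** The range lies in the span of the first factors of a finite sum of pure tensors. *)
Lemma range_act_dim_le x : exists n, dim_le (range (act x)) n.
Proof.
have [s ->] := tensor_sum x; exists (size s).
apply: (@dim_le_span _ _ _ (fun i => (nth 0 s i).1)) => _ [u _ <-].
exists (fun i => form u (nth 0 s i).2).
by rewrite act_sum (big_nth 0) big_mkord.
Qed.

(** * Consequences of symmetry and nondegeneracy of the form *)

Hypothesis form_sym : commutative form.
Hypothesis form_nondeg : nondegenerate_form form.

Lemma nondegenerate_dual v : v != 0 -> exists u, form u v = 1.
Proof.
move=> v0; have [u uv] : exists u, form u v != 0.
  apply: contrapT => uv; case/eqP: v0; apply: form_nondeg => u.
  by rewrite form_sym; apply/eqP/negP => /negP ?; apply: uv; exists u.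
by exists ((form u v)^-1 *: u); rewrite formZl mulVf.
Qed.

(** Coefficients are absorbed into the first factors, so the second factors stay in [A] even when
    [A] is a mere set. *)
Lemma pure_span_seq N A x : is_subspace N ->
  linear_span [set tens u v | u in N & v in A] x ->
  exists2 s : seq (V * V), forall p, p \in s -> A p.2 &
    x = \sum_(p <- s) tens p.1 p.2.
Proof.
move=> sN; apply: (@linear_span_min _ _ _ [set x | exists2 s : seq (V * V),
  forall p, p \in s -> A p.2 & x = \sum_(p <- s) tens p.1 p.2]).
  split=> [|a _ _ [s1 s1A ->] [s2 s2A ->]]; first by exists nil; rewrite ?big_nil.
  exists ([seq (a *: p.1, p.2) | p <- s1] ++ s2).
    by move=> p; rewrite mem_cat => /orP[/mapP[q /s1A Aq ->]|/s2A].
  rewrite big_cat big_map scaler_sumr /=; congr (_ + _).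
  by apply: eq_bigr => p _; rewrite linearZl_LR.
move=> _ [u Nu [v Av <-]]; exists [:: (u, v)]; last by rewrite big_seq1.
by move=> p; rewrite inE => /eqP ->.
Qed.

(* If [x = p (x) q + ...] with [q != 0] and [u] is dual to [q], then subtracting
   [x u (x) q] leaves a sum with one term less. *)
Lemma range_pure_span N A x : is_subspace N -> is_subspace A ->
  linear_span [set tens u v | u in [set: V] & v in A] x ->
  range (act x) `<=` N -> linear_span [set tens u v | u in N & v in A] x.
Proof.
move=> sN sA /(pure_span_seq subspaceT)[s + -> Ns].
have {Ns} : forall u, N (act (\sum_(p <- s) tens p.1 p.2) u).
  by move=> u; apply: Ns; exists u.
have sT := linear_span_subspace [set tens u v | u in N & v in A].
have [n] := ubnP (size s); elim: n s => // n IHn [_ _ _|[p q] s sn Ns As].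
  by rewrite big_nil; case: sT.
have As' r : r \in s -> A r.2 by move=> rs; apply: As; rewrite inE rs orbT.
have [q0|q0] := eqVneq q 0.
  have qE : \sum_(r <- (p, q) :: s) tens r.1 r.2 = \sum_(r <- s) tens r.1 r.2.
    by rewrite big_cons q0 linear0r add0r.
  by rewrite qE in Ns *; apply: IHn.
have [u uq] := nondegenerate_dual q0.
set y := \sum_(r <- _) _ in Ns *.
(* Since [act y u] is [p] plus the sum of [form u r.2 *: r.1], subtracting [tens (act y u) q]
   cancels the first term and shifts every other second factor by a multiple of [q]. *)
pose s' := [seq (r.1, r.2 - form u r.2 *: q) | r <- s].
have yE : y = tens (act y u) q + \sum_(r <- s') tens r.1 r.2.
  rewrite act_sum /y !big_cons /= uq scale1r linearDl /= -addrA; congr (_ + _).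
  rewrite linear_sumlz big_map -big_split /=; apply: eq_bigr => r _.
  by rewrite linearBr linearZl_LR linearZr_LR addrC subrK.
have Aq : A q by apply: (As (p, q)); rewrite mem_head.
rewrite yE; apply: (subspaceD sT).
  by apply: subset_linear_span; exists (act y u) => //; exists q.
apply: IHn => [|v|r /mapP[r' /As' Ar ->]]; first by rewrite size_map.
- have -> : \sum_(r <- s') tens r.1 r.2 = y - tens (act y u) q.
    by rewrite {1}yE addrC addKr.
  by rewrite linearBl /= act_tens; apply: subspaceB => //; apply: subspaceZ.
- by apply: subspaceB => //; apply: subspaceZ.
Qed.

Lemma tensor_pure_span x : linear_span [set tens u v | u in [set: V] & v in [set: V]] x.
Proof.
have [s ->] := tensor_sum x; apply: (subspace_sum _ (linear_span_subspace _)) => p.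
by apply: subset_linear_span; exists p.1 => //; exists p.2.
Qed.

(** The case of zero range in [range_pure_span]: such a tensor lies in the span of the tensors
    [tens 0 v]. *)
Lemma act_inj x : (forall u, act x u = 0) -> x = 0.
Proof.
move=> x0.
have : linear_span [set tens u v | u in [set 0] & v in [set: V]] x.
  apply: (range_pure_span subspace0 subspaceT (tensor_pure_span x)) => _ [u _ <-].
  exact: x0.
apply: (linear_span_min subspace0) => _ [_ -> [v _ <-]].
by rewrite linear0l.
Qed.

Lemma so_skew x : so x -> forall u v, form (act x u) v = - form u (act x v).
Proof.
apply: (@linear_span_min _ _ _ [set x | forall u v,
  form (act x u) v = - form u (act x v)]).
  split=> [|a y z yP zP] u v /=; first by rewrite !linear0l linear0r oppr0.
  by rewrite !linearPl linearPr /= yP zP opprD mulrN.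
move=> _ [p _ [q _ <-]] u v; rewrite !act_wedge formBl formBr !formZl !formZr.
by rewrite opprB [form v q]form_sym [form v p]form_sym [form q v * _]mulrC
  [form p v * _]mulrC [form u p * _]mulrC [form u q * _]mulrC.
Qed.

Lemma tmul_tensl x v w : tmul x (tens v w) = tens (act x v) w.
Proof. exact: tlift_tens. Qed.

(** Right multiplication acts on the second factor through the adjoint of [x], which is [- x]. *)
Lemma tmul_tensr x v w : so x -> tmul (tens v w) x = - tens v (act x w).
Proof.
apply: (@linear_span_min _ _ _ [set x | tmul (tens v w) x = - tens v (act x w)]).
  split=> [|a y z /= yP zP] /=; first by rewrite linear0r linear0l linear0r oppr0.
  by rewrite linearPr linearPl linearPr /= yP zP opprD scalerN.
move=> _ [p _ [q _ <-]] /=; rewrite act_wedge /wedge linearBr /= !tmul_tens.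
by rewrite linearBr opprB !linearZr_LR /= [form p w]form_sym [form q w]form_sym.
Qed.

Lemma bracket_tens x v w : so x ->
  bracket x (tens v w) = tens (act x v) w + tens v (act x w).
Proof. by move=> sx; rewrite /Defs.bracket tmul_tensl tmul_tensr // opprK. Qed.

(** The adjoint action is the natural one on the exterior square, so eigenvalues of [x] on [v] and
    [w] add up on their wedge. *)
Lemma bracket_wedge x v w : so x ->
  bracket x (wedge v w) = wedge (act x v) w + wedge v (act x w).
Proof.
move=> sx; rewrite {1}/wedge linearB /= !bracket_tens // /wedge.
by rewrite [X in _ - X]addrC opprD addrACA.
Qed.

Lemma so_bracket x y : so x -> so y -> so (bracket x y).
Proof.
move=> sx; apply: (linear_span_min (subspace_preimage (bracket x) (ext2_subspace _))).
move=> _ [v _ [w _ <-]] /=; rewrite bracket_wedge //.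
by apply: (subspaceD (ext2_subspace _)); apply: wedge_so.
Qed.

(** * The flip of the two tensor factors *)

Definition tens_rev (u v : V) : tensor V V := tens v u.

Lemma tens_rev_bilinear : bilinear_for *:%R *:%R tens_rev.
Proof. by split=> w a u v; rewrite /tens_rev ?linearPr ?linearPl. Qed.

HB.instance Definition _ := bilinear_isBilinear.Build K _ _ _ _ _
  tens_rev tens_rev_bilinear.

Definition tens_swap (x : tensor V V) : tensor V V := tlift tens_rev x.

Lemma tens_swap_linear : linear tens_swap.
Proof. exact: tlift_linear. Qed.

HB.instance Definition _ := GRing.isLinear.Build K _ _ _ tens_swap
  tens_swap_linear.

Lemma tens_swap_tens u v : tens_swap (tens u v) = tens v u.
Proof. exact: tlift_tens. Qed.

Lemma so_swap x : so x -> tens_swap x = - x.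
Proof.
apply: (@linear_span_min _ _ _ [set x | tens_swap x = - x]).
  split=> [|a y z /= yP zP] /=; first by rewrite linear0 oppr0.
  by rewrite tens_swap_linear yP zP opprD scalerN.
by move=> _ [p _ [q _ <-]] /=; rewrite /wedge linearB /= !tens_swap_tens opprB.
Qed.

(* [x = n (x) v + ...] with all [n] in [N], and the flip of [x] is [- x], so the
   [v] can be moved to [N] as well. *)
Lemma so_range_ext2 N x : 2%:R != 0 :> K -> is_subspace N ->
  so x -> range (act x) `<=` N -> ext2 N x.
Proof.
move=> K2 sN sx xN.
have NT := range_pure_span sN subspaceT (tensor_pure_span x) xN.
have : linear_span [set tens u v | u in N & v in N] (tens_swap x).
  apply: range_pure_span => //.
    move: NT; apply: (@linear_span_min _ _ _ (tens_swap @^-1` linear_span _)).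
      exact: (subspace_preimage tens_swap (linear_span_subspace _)).
    move=> _ [u Nu [v _ <-]] /=; rewrite tens_swap_tens.
    by apply: subset_linear_span; exists v => //; exists u.
  move=> _ [u _ <-]; rewrite so_swap // linearNl -scaleN1r.
  by apply: subspaceZ => //; apply: xN; exists u.
rewrite so_swap // => NN.
(* The flip minus the identity sends a pure tensor over [N] to a wedge, and sends [- x] to twice
   [x]. *)
have : ext2 N (tens_swap (- x) - - x).
  move: (- x) NN; apply: linear_span_min.
    split=> [|a y z /= yP zP] /=.
      by rewrite linear0 subrr; case: (ext2_subspace N).
    rewrite tens_swap_linear opprD addrACA -scalerBr.
    by case: (ext2_subspace N) => _; apply.
  by move=> _ [u Nu [v Nv <-]] /=; rewrite tens_swap_tens; apply: wedge_ext2.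
rewrite linearN /= so_swap // !opprK => /(subspaceZ 2%:R^-1 (ext2_subspace N)).
by rewrite -mulr2n -scaler_nat scalerA mulVf // scale1r.
Qed.

End OrthogonalAlgebra.

Lemma linear_span_seq (K : fieldType) (M : lmodType K) (A : set M) v :
  linear_span A v -> exists2 s : seq M, forall u, u \in s -> A u &
    linear_span [set u | u \in s] v.
Proof.
apply: (@linear_span_min _ _ _ [set v | exists2 s : seq M,
  forall u, u \in s -> A u & linear_span [set u | u \in s] v]).
  split=> [|a u w [s sA su] [r rA rw]].
    by exists nil => //; exact: (proj1 (linear_span_subspace _)).
  exists (s ++ r); first by move=> x; rewrite mem_cat => /orP[/sA|/rA].
  have sS := linear_span_subspace [set x | x \in s ++ r].
  case: (sS) => _; apply; [move: su|move: rw]; apply: linear_span_mono => x /=;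
    by rewrite mem_cat => ->; rewrite ?orbT.
move=> u Au; exists [:: u]; first by move=> x; rewrite inE => /eqP ->.
by apply: subset_linear_span; rewrite /= inE.
Qed.

(** With [n = size s], the conditions are [n] linear equations in the coefficients of [n.+1]
    independent vectors. *)
Lemma countably_infinite_dimensional_orthogonal (K : fieldType) (V : lmodType K)
    (form : {biscalar V}) (s : seq V) :
  countably_infinite_dimensional V ->
  exists2 w, w != 0 & forall q, q \in s -> form w q = 0.
Proof.
move=> [e [_ e_free]]; set n := size s.
have [c c0 cs] := exists_left_kernel
  (\matrix_(i < n.+1, j < n) form (e i) (nth 0 s j)) (ltnSn n).
exists (\sum_(i < n.+1) c 0 i *: e i).
  apply: contraNneq c0 => /(e_free _ (c 0)) c0.
  by apply/eqP/rowP => i; rewrite c0 mxE.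
move=> q /(nthP 0)[j jn <-].
move/rowP: cs => /(_ (Ordinal jn)); rewrite !mxE => cs.
rewrite linear_sumlz -[RHS]cs; apply: eq_bigr => i _.
by rewrite mxE linearZl_LR.
Qed.

(** * Semisimple elements and toral subalgebras *)

Section Toral.
Context {K : numClosedFieldType} {V : lmodType K}.
Variable form : {biscalar V}.
Hypothesis V_dim : countably_infinite_dimensional V.
Hypothesis form_sym : commutative form.
Hypothesis form_nondeg : nondegenerate_form form.
Variable g : nat -> set (tensor V V).
Hypothesis g_exh : reductive_exhaustion form g.

Local Notation act := (act form).
Local Notation bracket := (bracket form).
Local Notation semisimple_elt := (semisimple_elt form g).

Lemma exhaustion_mono m n : (m <= n)%N -> g m `<=` g n.
Proof.
have [_ gS _] := g_exh; move=> /subnKC <-; elim: (n - m)%N => [|k IHk].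
  by rewrite addn0.
by rewrite addnS; apply: subset_trans IHk _; case: (gS (m + k)%N).
Qed.

Lemma exhaustion_so n : g n `<=` so (V := V).
Proof. by have [_ _ <-] := g_exh => x gx; exists n. Qed.

Lemma exhaustion_bracket n x y : g n x -> g n y -> g n (bracket x y).
Proof. by have [+ _ _] := g_exh => /(_ n)[[_ gB] _ _]; apply: gB. Qed.

(** By nesting, [x] and [y] lie in a common finite-dimensional [g n], where semisimplicity of [ad x]
    yields eigenvectors through [complement_eigvec]. *)
Lemma semisimple_ad_eigvec x y :
  semisimple_elt x -> so y -> linear_span (eigvec (bracket x)) y.
Proof.
move=> [sx xss] sy; have [g_sub _ gE] := g_exh.
have [m _ gx] : (\bigcup_n g n) x by rewrite gE.
have [n _ gy] : (\bigcup_n g n) y by rewrite gE.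
have {}gx := exhaustion_mono (leq_maxl m n) gx.
have {}gy := exhaustion_mono (leq_maxr m n) gy.
have [[sg _] gfin _] := g_sub (maxn m n).
have [k gk] := finite_dimensional_dim_le gfin.
have /(_ y gy) : g (maxn m n) `<=` linear_span (eigvec (bracket x) `&` g (maxn m n)).
  apply: (complement_eigvec sg gk) => [z|N sN Ng xN]; first exact: exhaustion_bracket.
  have [|N' [sN' xN' gNN']] := xss _ gx N sN Ng; first by move=> _ z -> /xN.
  by exists N'; split => // z; apply: xN'.
by apply: linear_span_mono => z [].
Qed.

(** Wedging with a kernel vector of [x] carries the action on [V] over to the adjoint action, Jordan
    blocks included. *)
Lemma pencil_bracket_wedge x s v w : so x -> act x w = 0 ->
  pencil (bracket x) s (wedge v w) = wedge (pencil (act x) s v) w.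
Proof.
move=> sx xw; elim: s => //= a s ->.
by rewrite (bracket_wedge form_sym) // xw linear0r addr0 linearBl linearZl_LR.
Qed.

(* [x] has finite rank, so its kernel contains [w] independent of [u], the
   second vector of a would-be Jordan block [v, u]; then [v /\ w] and [u /\ w]
   form a Jordan block of [ad x]. *)
Lemma semisimple_act_no_jordan x a v : semisimple_elt x ->
  pencil (act x) [:: a; a] v = 0 -> act x v = a *: v.
Proof.
move=> ssx v0; have [sx _] := ssx; apply/eqP; rewrite -subr_eq0; apply/negP => /negP.
set u := act x v - a *: v => u0; have [p pu] := nondegenerate_dual form_sym form_nondeg u0.
have [s xE] := tensor_sum x.
(* Orthogonality to the second factors of [x] gives [act x w = 0]; orthogonality to [p] separates
   [w] from [u]. *)
have [w w0 ws] := countably_infinite_dimensional_orthogonal form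
  (p :: [seq q.2 | q <- s]) V_dim.
have xw : act x w = 0.
  rewrite xE act_sum big_seq big1 // => q qs.
  by rewrite ws ?scale0r // inE map_f ?orbT.
have := eigvec_no_jordan (semisimple_ad_eigvec ssx (wedge_so v w)).
move=> /(_ a); rewrite pencil_bracket_wedge // v0 linear0l => /(_ erefl).
rewrite /= (bracket_wedge form_sym) // xw linear0r addr0 -linearZl_LR => /eqP.
rewrite -subr_eq0 -linearBl -/u => /eqP uw.
(* The wedge of [u] and [w] sends [p] to [- w], so it cannot vanish. *)
have := congr1 (fun y => act y p) uw; rewrite act_wedge pu linear0l.
rewrite form_sym ws ?mem_head // scale0r scale1r sub0r => /eqP.
by rewrite oppr_eq0 (negPf w0).
Qed.

(** Finite rank makes [x] locally finite, and [semisimple_act_no_jordan] removes the repeated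
    roots. *)
Lemma semisimple_act_eigvec x v :
  semisimple_elt x -> linear_span (eigvec (act x)) v.
Proof.
move=> ssx; have [n xn] := range_act_dim_le form x.
have [s sv] : exists s, pencil (act x) s (act x v) = 0.
  apply: (pencil_annihilates xn); last by exists v.
  by move=> _ [u _ <-]; exists (act x u).
have : linear_span (eigvec (act x) `&` [set: V]) v.
  (* The extra root 0 accounts for the passage from [act x v], killed by [s], to [v]. *)
  apply: (@pencil_no_jordan_eigvec _ _ (act x) _ (0 :: s)) => // [a u _|/=].
    exact: semisimple_act_no_jordan.
  by rewrite -pencilC sv scale0r subr0.
by apply: linear_span_mono => u [].
Qed.

Lemma act_eigvec_ad x y : so x -> (forall v, linear_span (eigvec (act x)) v) ->
  so y -> linear_span (eigvec (bracket x)) y.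
Proof.
move=> sx xE; have sE := linear_span_subspace (eigvec (bracket x)).
apply: (linear_span_min sE) => _ [v _ [w _ <-]].
move: v (xE v); apply: linear_span_min.
  split=> [|c v v' /= vw v'w]; first by rewrite /= linear0l; case: sE.
  by rewrite /= linearPl; case: sE => _; apply.
move=> v [a xv] /=; move: w (xE w); apply: linear_span_min.
  exact: (subspace_preimage (wedge v) sE).
move=> w [b xw]; apply: subset_linear_span; exists (a + b).
by rewrite (bracket_wedge form_sym) // xv xw linearZl_LR linearZr_LR scalerDl.
Qed.

(** Each [g n] containing [x] is spanned by finitely many eigenvectors of [ad x], from which
    [eigvec_seq_complement] builds stable complements. *)
Lemma act_eigvec_semisimple x : so x ->
  (forall v, linear_span (eigvec (act x)) v) -> semisimple_elt x.
Proof.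
move=> sx xE; split=> // n gx N sN Ng xN.
have [g_sub _ _] := g_exh; have [[sg _] [d [e ge]] _] := g_sub n.
have /choice[s sP] : forall i : 'I_d, exists s : seq (tensor V V),
    (forall u, u \in s -> (eigvec (bracket x) `&` g n) u) /\
    linear_span [set u | u \in s] (e i).
  move=> i; have ei : g n (e i) by rewrite ge; apply: subset_linear_span; exists i.
  have gb : stable (bracket x) (g n) by move=> z; apply: exhaustion_bracket.
  have := eigvec_stable sg gb ei (act_eigvec_ad sx xE (exhaustion_so ei)).
  by move=> /linear_span_seq[s ? ?]; exists s.
pose r := flatten [seq s i | i <- enum 'I_d].
have rP u : u \in r -> (eigvec (bracket x) `&` g n) u.
  by move=> /flatten_mapP[i _]; apply: (proj1 (sP i)).
have gr : g n `<=` linear_span [set u | u \in r].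
  rewrite ge; apply: linear_span_min; first exact: linear_span_subspace.
  move=> _ [i _ <-]; apply: linear_span_mono (proj2 (sP i)) => u us.
  by apply/flatten_mapP; exists i; rewrite ?mem_enum.
have xN' : stable (bracket x) N by move=> z; apply: xN.
have [u /rP[]//|N' [sN' fN' N'N N'r rN']] :=
  eigvec_seq_complement (f := bracket x) (e := r) sN xN'.
exists N'; split=> //; first by move=> _ z -> /fN'.
split; last by rewrite setIC.
apply/seteqP; split=> [z /gr|_ [y Ny [z N'z <-]]].
  move: z; apply: linear_span_min => //.
  split=> [|a _ _ [y Ny [z N'z <-]] [y' Ny' [z' N'z' <-]]].
    by exists 0; [case: sN|exists 0; [case: sN'|rewrite addr0]].
  exists (a *: y + y'); first by case: sN => _; apply.
  exists (a *: z + z'); first by case: sN' => _; apply.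
  by rewrite scalerDr addrACA.
apply: subspaceD => //; first exact: Ng.
by apply: (linear_span_min sg _ (N'r _ N'z)) => u /rP[].
Qed.

Section Abelian.
Variable t : set (tensor V V).
Hypothesis t_toral : toral form g t.

(* An eigenvector [y] of [ad x] spans with [x] an algebra on which [ad y] is
   nilpotent. *)
Lemma toral_abelian x y : t x -> t y -> bracket x y = 0.
Proof.
have [[st tB] tso tss] := t_toral => tx ty.
have := semisimple_ad_eigvec (tss _ tx) (tso _ ty).
move=> /(eigvec_stable st (fun z => tB x z tx) ty).
apply: (linear_span_min (subspace_preimage (bracket x) subspace0)).
move=> {ty} z [[a xz] tz] /=.
have := eigvec_no_jordan (f := bracket z) (a := 0)
  (semisimple_ad_eigvec (tss _ tz) (tso _ tx)).
rewrite /= [bracket z x]bracketC xz !scale0r !subr0 linearN linearZ /=.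
by rewrite bracketxx scaler0 oppr0 => /(_ erefl) /eqP; rewrite oppr_eq0 => /eqP.
Qed.

End Abelian.

Variable t : set (tensor V V).
Hypothesis t_max : maximal_toral form g t.

(** The wedge [h] has eigenvalue 1 on [v], -1 on [w] and 0 on their orthogonal space. As [h]
    commutes with [t], adjoining it gives a toral subalgebra, which maximality equates with [t]. *)
Lemma maximal_toral_hyperbolic v w :
  form v v = 0 -> form w w = 0 -> form v w = 1 ->
  (forall x, t x -> bracket x (wedge v w) = 0) -> t (wedge v w).
Proof.
move=> vv ww vw th; have [t_toral tmax] := t_max; have [[st tB] tso tss] := t_toral.
set h := wedge v w in th *; have hE u : act h u = form u w *: v - form u v *: w.
  exact: act_wedge.
have tab := toral_abelian t_toral.
set t' := linear_span (t `|` [set h]).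
have tt' : t `<=` t' by move=> x tx; apply: subset_linear_span; left.
suff : toral form g t' by move=> /tmax/(_ tt') <-; apply: subset_linear_span; right.
have st' : is_subspace t' by exact: linear_span_subspace.
have hdiag u : linear_span (eigvec (act h)) u.
  have sE := linear_span_subspace (eigvec (act h)).
  (* Splits [u] into its part orthogonal to [v] and [w] and its components along [v] and [w]. *)
  rewrite -[u](subrK (form u w *: v + form u v *: w)).
  have eig0 a z : act h z = a *: z -> linear_span (eigvec (act h)) z.
    by move=> hz; apply: subset_linear_span; exists a.
  apply: (subspaceD sE); last apply: (subspaceD sE).
  - apply: (eig0 0); rewrite hE !formBl !formDl !formZl [form w v]form_sym vv ww vw.
    by rewrite !mulr0 !mulr1 addr0 add0r !subrr !scale0r subrr.
  - apply: (subspaceZ _ sE); apply: (eig0 1).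
    by rewrite hE vv vw scale0r subr0.
  - apply: (subspaceZ _ sE); apply: (eig0 (- 1)).
    by rewrite hE ww form_sym vw scale0r sub0r scaleN1r scale1r.
have so_h : so h by exact: wedge_so.
split.
- split=> // x y /(linear_spanU_line st)[x1 tx1 [a ->]].
  move=> /(linear_spanU_line st)[y1 ty1 [b ->]].
  rewrite linearDl !linearDr !linearZl_LR !linearZr_LR /= tab // th //.
  rewrite [bracket h _]bracketC th // bracketxx oppr0 !scaler0 !addr0.
  by case: st'.
- apply: linear_span_min; first exact: ext2_subspace.
  by move=> x [/tso//|->].
- move=> _ /(linear_spanU_line st)[x tx [c ->]].
  apply: act_eigvec_semisimple => [|u].
    apply: (subspaceD (ext2_subspace _)); first exact: tso.
    by apply: (subspaceZ _ (ext2_subspace _)).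
  apply: (@eigvec_comm _ _ (act x) (act h) _ c) => // z.
  + exact/bracket_comm/th.
  + by rewrite /= linearDl linearZl_LR.
  + exact: semisimple_act_eigvec (tss _ tx).
Qed.

End Toral.

(** * The centralizer of a maximal toral subalgebra *)

Section Centralizer.
Context {K : numClosedFieldType} {V : lmodType K}.
Variable form : {biscalar V}.
Hypothesis V_dim : countably_infinite_dimensional V.
Hypothesis form_sym : commutative form.
Hypothesis form_nondeg : nondegenerate_form form.
Variable g : nat -> set (tensor V V).
Hypothesis g_exh : reductive_exhaustion form g.
Variable t : set (tensor V V).
Hypothesis t_max : maximal_toral form g t.

Local Notation act := (act form).
Local Notation bracket := (bracket form).
Local Notation V0 := (gen_zero_weight_space form t).
Local Notation z := (centralizer form t).

Let two_neq0 : 2%:R != 0 :> K. Proof. by rewrite pnatr_eq0. Qed.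

Let t_toral : toral form g t. Proof. by case: t_max. Qed.
Let t_sub : is_subspace t. Proof. by case: t_toral => -[]. Qed.
Let t_so : t `<=` so (V := V). Proof. by case: t_toral. Qed.
Let t_ss x : t x -> semisimple_elt form g x. Proof. by case: t_toral => _ _; apply. Qed.
Let t_ab x y : t x -> t y -> bracket x y = 0.
Proof. exact: (toral_abelian g_exh t_toral). Qed.

Lemma centralizer_subspace : is_subspace z.
Proof.
split=> [|a y y' [sy ty] [sy' ty']].
  by split=> [|x _]; [case: (ext2_subspace [set: V])|rewrite linear0r].
split=> [|x tx]; first by case: (ext2_subspace [set: V]) => _; apply.
by rewrite linearPr /= ty // ty' // scaler0 addr0.
Qed.

Lemma centralizer_bracket x y : z x -> z y -> z (bracket x y).
Proof.
move=> [sx tx] [sy ty]; split=> [|u tu]; first exact: so_bracket.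
by rewrite jacobi (tx u tu) (ty u tu) linear0l linear0r addr0.
Qed.

Lemma toral_centralizer : t `<=` z.
Proof. by move=> x tx; split=> [|y ty]; [apply: t_so|apply: t_ab]. Qed.

Lemma toral_square0 x u : t x -> act x (act x u) = 0 -> act x u = 0.
Proof.
move=> tx xxu.
have := semisimple_act_no_jordan V_dim form_sym form_nondeg g_exh
  (a := 0) (v := u) (t_ss tx).
by rewrite /= !scale0r !subr0; apply.
Qed.

(** Elements of [t] have no Jordan block at 0, so generalized zero weight vectors are annihilated by
    [t]. *)
Lemma zero_weight_spaceP u : V0 u <-> forall x, t x -> act x u = 0.
Proof.
split=> [[[|i] // _ tu] x tx|tu]; last by exists 1%N => //.
have := tu x tx; elim: i {tu} => //= i IHi xu.
exact/IHi/(toral_square0 tx xu).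
Qed.

Lemma zero_weight_space_subspace : is_subspace V0.
Proof.
split=> [|a u v /zero_weight_spaceP tu /zero_weight_spaceP tv];
  apply/zero_weight_spaceP => x tx; first by rewrite linear0r.
by rewrite linearPr /= tu // tv // scaler0 addr0.
Qed.

Lemma ext2_zero_weight_centralizer : ext2 V0 `<=` z.
Proof.
apply: (linear_span_min centralizer_subspace).
move=> _ [u /zero_weight_spaceP tu [v /zero_weight_spaceP tv <-]].
split=> [|x tx]; first exact: wedge_so.
by rewrite (bracket_wedge form_sym) ?tu ?tv ?linear0l ?linear0r ?addr0 //; apply: t_so.
Qed.

(** An element of [ext2 V0] has its range in [V0], which [t] kills; so an [x] in both has square
    zero and, being semisimple, is zero. *)
Lemma toral_ext2_zero_weight : t `&` ext2 V0 = [set 0].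
Proof.
apply/seteqP; split=> [x [tx V0x]|x ->]; last first.
  by split; [case: t_sub|case: (ext2_subspace V0)].
apply: (act_inj form_sym form_nondeg) => u; apply: (toral_square0 tx).
by have /zero_weight_spaceP := ext2_range form u zero_weight_space_subspace V0x; apply.
Qed.

(** * Weight vectors of [t] in [V] *)

Definition weight (alpha : tensor V V -> K) (v : V) :=
  forall x, t x -> act x v = alpha x *: v.

Lemma weight_span W n : is_subspace W -> dim_le W n ->
  (forall x, t x -> stable (act x) W) ->
  W `<=` linear_span [set v | W v /\ exists alpha, weight alpha v].
Proof.
move=> sW Wn tW.
apply: (joint_eigvec_span (P := t) (F := fun x => act x : {linear V -> V}) _ _ sW Wn tW).
  by move=> x y tx ty u /=; apply: bracket_comm; apply: t_ab.
move=> x tx u.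
exact: (semisimple_act_eigvec V_dim form_sym form_nondeg g_exh u (t_ss tx)).
Qed.

(** Skewness of [x] gives [alpha x * form v w = - (beta x * form v w)]. *)
Lemma weight_form alpha beta v w x : weight alpha v -> weight beta w -> t x ->
  form v w != 0 -> beta x = - alpha x.
Proof.
move=> av bw tx vw0; apply: (mulIf vw0); rewrite mulNr.
rewrite -[alpha x * _]formZl -[beta x * _]formZr -av // -bw //.
by rewrite (so_skew form_sym) ?opprK //; apply: t_so.
Qed.

Lemma weight_isotropic alpha v w x : weight alpha v -> weight alpha w ->
  t x -> alpha x != 0 -> form v w = 0.
Proof.
move=> av aw tx ax0; apply/eqP; apply: contraNT ax0 => /(weight_form av aw tx) /eqP.
by rewrite -addr_eq0 -mulr2n -mulr_natl mulf_eq0 (negPf two_neq0).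
Qed.

(** [e] is not orthogonal to the range of [x0], since [form e (act x0 m) = - alpha x0] for [m] dual
    to [e]. That range is spanned by weight vectors, so one of them pairs with [e], and its weight
    is opposite. *)
Lemma weight_pair alpha e x0 : e != 0 -> weight alpha e -> t x0 -> alpha x0 != 0 ->
  exists f, [/\ weight (fun x => - alpha x) f, form e f = 1 & t (wedge e f)].
Proof.
move=> e0 ae tx0 ax0; have [m me] := nondegenerate_dual form_sym form_nondeg e0.
have [n xn] := range_act_dim_le form x0.
have [f [beta bf ef]] : exists f, exists2 beta, weight beta f & form e f != 0.
  apply: contrapT => noef; case/eqP: ax0.
  suff : form e (act x0 m) = 0.
    have := so_skew form_sym (t_so tx0) e m; rewrite ae // formZl.
    rewrite [form e m]form_sym me mulr1.
    by move=> -> ->; rewrite oppr0.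
  have xW x : t x -> stable (act x) (range (act x0)).
    move=> tx _ [u _ <-]; exists (act x u) => //.
    by apply: bracket_comm; apply: t_ab.
  have := weight_span (range_act_subspace form x0) xn xW (imageP _ I : range _ (act x0 m)).
  apply: (linear_span_min (orthogonal_subspace form e)).
  move=> f [_ [beta bf]] /=; apply/eqP/negP => /negP ef.
  by apply: noef; exists f; exists beta.
exists ((form e f)^-1 *: f).
have bE x : t x -> beta x = - alpha x by move=> tx; exact: weight_form ef.
have wf : weight (fun x => - alpha x) ((form e f)^-1 *: f).
  by move=> x tx; rewrite linearZr_LR /= bf // bE // !scalerA mulrC.
have ef1 : form e ((form e f)^-1 *: f) = 1 by rewrite formZr mulVf.
split=> //; move: ((form e f)^-1 *: f) wf ef1 => f' wf ef1.
apply: (maximal_toral_hyperbolic V_dim form_sym form_nondeg g_exh t_max) => //.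
- exact: (weight_isotropic ae ae tx0 ax0).
- by apply: (weight_isotropic wf wf tx0); rewrite oppr_eq0.
(* Opposite weights cancel on the wedge. *)
- move=> x tx; rewrite (bracket_wedge form_sym) ?ae ?wf //; last exact: t_so.
  by rewrite linearZl_LR linearZr_LR /= scaleNr subrr.
Qed.

(** On the weight space, [wedge e f] acts both as a scalar, being in [t], and as [v] to
    [form v f *: e]; evaluation at [e] shows that the scalar is 1. *)
Lemma weight_one_dim alpha e f u x0 : e != 0 -> weight alpha e ->
  weight (fun x => - alpha x) f -> form e f = 1 -> t (wedge e f) ->
  t x0 -> alpha x0 != 0 -> weight alpha u -> u = form u f *: e.
Proof.
move=> e0 ae af ef th tx0 ax0 au.
have isot v w : weight alpha v -> weight alpha w -> form v w = 0.
  by move=> av aw; apply: (weight_isotropic av aw tx0 ax0).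
have hE v : weight alpha v -> alpha (wedge e f) *: v = form v f *: e.
  by move=> av; rewrite -av // act_wedge (isot v e) // scale0r subr0.
have h1 : alpha (wedge e f) = 1.
  have /eqP := hE e ae; rewrite ef -subr_eq0 -scalerBl scaler_eq0 (negPf e0) orbF.
  by rewrite subr_eq0 => /eqP.
by rewrite -hE // h1 scale1r.
Qed.

(* Each step removes from the range of [y] a weight vector of nonzero weight. *)
Lemma centralizer_decomposition y : z y -> exists2 x, t x & ext2 V0 (y - x).
Proof.
have [n] := range_act_dim_le form y; elim: n y => [|n IHn] y yn zy.
  have -> : y = 0.
    by apply: (act_inj form_sym form_nondeg) => u; apply: (dim_le0 yn); exists u.
  by exists 0; [case: t_sub|rewrite subrr; case: (ext2_subspace V0)].
have [sy ty] := zy; have sV0 := zero_weight_space_subspace.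
have ycomm x u : t x -> act x (act y u) = act y (act x u).
  by move=> tx; apply: bracket_comm; apply: ty.
have [yV0|yV0] := pselect (range (act y) `<=` V0).
  exists 0; first by case: t_sub.
  by rewrite subr0; apply: so_range_ext2.
have sR := range_act_subspace form y.
have [e [Re [alpha ae] eV0]] : exists e,
    [/\ range (act y) e, exists alpha, weight alpha e & ~ V0 e].
  apply: contrapT => noe; apply: yV0.
  apply: subset_trans (weight_span sR yn _) _.
    by move=> x tx _ [u _ <-]; exists (act x u); rewrite // ycomm.
  apply: (linear_span_min sV0) => v [Rv av].
  by apply: contrapT => nv; apply: noe; exists v.
have e0 : e != 0 by apply: contra_notN eV0 => /eqP ->; case: sV0.
have [x0 tx0 ax0] : exists2 x, t x & alpha x != 0.
  apply: contrapT => nox; apply: eV0; apply/zero_weight_spaceP => x tx.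
  rewrite ae //; have [->|ax] := eqVneq (alpha x) 0; first by rewrite scale0r.
  by case: nox; exists x.
have [f [af ef th]] := weight_pair e0 ae tx0 ax0.
have f0 : f != 0.
  by apply: contra_eq_neq ef => ->; rewrite form0r eq_sym oner_eq0.
have yweight beta u : weight beta u -> weight beta (act y u).
  by move=> bu x tx; rewrite ycomm // bu // linearZr_LR.
have thE : t (wedge f e).
  rewrite -[wedge f e]opprK /wedge opprB -/(wedge e f) -scaleN1r.
  exact: subspaceZ.
pose c := form (act y e) f.
have ye : act y e = c *: e.
  exact: (weight_one_dim e0 ae af ef th tx0 ax0 (yweight _ _ ae)).
(* The same lemma with [e] and [f] exchanged makes [f] an eigenvector of [y], and skewness gives its
   eigenvalue. *)
have yf : act y f = - c *: f.
  have fe : form f e = 1 by rewrite form_sym.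
  have ae' : weight (fun x => - - alpha x) e by move=> x tx; rewrite opprK ae.
  have := weight_one_dim f0 af ae' fe thE tx0; rewrite oppr_eq0 => /(_ (act y f) ax0).
  move=> /(_ (yweight _ _ af)) ->.
  by rewrite (so_skew form_sym) // ye formZr fe mulr1.
have ff : form f f = 0.
  by apply: (weight_isotropic af af tx0); rewrite oppr_eq0.
have y'E u : act (y - c *: wedge e f) u =
    act y u - c *: (form u f *: e - form u e *: f).
  by rewrite linearBl linearZl_LR /= act_wedge.
(* The new range stays in the old one, because [e] and [c *: f] lie there. It loses [e]: the new
   element kills [f], so by skewness its range is orthogonal to [f], whereas [form e f = 1]. *)
have /IHn : dim_le (range (act (y - c *: wedge e f))) n.
  apply: (dim_le_proper (range_act_subspace _ _) _ Re) yn => [_ [u _ <-]|[u _]].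
    rewrite y'E; apply: (subspaceB sR); first by exists u.
    rewrite scalerBr scalerA; apply: (subspaceB sR); first exact: subspaceZ.
    exists (- form u e *: f) => //.
    by rewrite linearZr_LR /= yf !scalerA mulrNN mulrC.
  rewrite y'E => eE; have /eqP := oner_neq0 K; apply.
  rewrite -ef -eE formBl formZl formBl !formZl.
  by rewrite ef ff mulr0 subr0 mulr1 (so_skew form_sym) // yf formZr mulNr opprK subrr.
case.
  apply: (subspaceB centralizer_subspace) => //.
  by apply: (subspaceZ _ centralizer_subspace); apply: toral_centralizer.
move=> x tx yx; exists (x + c *: wedge e f); last by rewrite opprD [- x + _]addrC addrA.
by apply: subspaceD => //; apply: subspaceZ.
Qed.

(** * The form on the zero weight space and nilpotency *)

Lemma polarization W : is_subspace W -> (forall u, W u -> form u u = 0) ->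
  forall u v, W u -> W v -> form u v = 0.
Proof.
move=> sW W0 u v Wu Wv; have := W0 _ (subspaceD sW Wu Wv).
rewrite formDl !formDr !W0 // add0r addr0 [form v u]form_sym => /eqP.
by rewrite -mulr2n -mulr_natl mulf_eq0 (negPf two_neq0) => /eqP.
Qed.

(** Otherwise [wedge v w] would lie in [t] by maximality, yet it fixes the vector [v], which [t]
    kills. *)
Lemma zero_weight_no_hyperbolic v w :
  V0 v -> V0 w -> form v v = 0 -> form w w = 0 -> form v w <> 1.
Proof.
move=> V0v V0w vv ww vw.
have th : t (wedge v w).
  apply: (maximal_toral_hyperbolic V_dim form_sym form_nondeg g_exh t_max) => // x tx.
  by case: (ext2_zero_weight_centralizer (wedge_ext2 V0v V0w)) => _; apply.
have /zero_weight_spaceP/(_ _ th) := V0v.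
rewrite act_wedge vw vv scale1r scale0r subr0 => v0.
by have /eqP := oner_neq0 K; apply; rewrite -vw v0 form0l.
Qed.

(* Two orthogonal anisotropic vectors of [V0] would span a hyperbolic plane. *)
Lemma zero_weight_form_rank1 a b c d : V0 a -> V0 b -> V0 c -> V0 d ->
  form a b * form c d = form a c * form b d.
Proof.
move=> V0a V0b V0c V0d; have sV0 := zero_weight_space_subspace.
have [[e V0e q0]|isot] := pselect (exists2 e, V0 e & form e e != 0); last first.
  have form0 u v : V0 u -> V0 v -> form u v = 0.
    apply: polarization => // w V0w; apply/eqP/negP => /negP ww.
    by apply: isot; exists w.
  by rewrite !form0 // mul0r.
set q := form e e in q0.
have sW : is_subspace (V0 `&` [set u | form e u = 0]).
  exact: (subspaceI sV0 (orthogonal_subspace form e)).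
have orth u v : V0 u -> V0 v -> form e u = 0 -> form e v = 0 -> form u v = 0.
  move=> V0u V0v eu ev; apply: (polarization sW) => // w [V0w /= ew].
  apply/eqP/negP => /negP p0; set p := form w w in p0.
  (* With this [s] both [e + s w] and [e - s w] are isotropic and pair to [2 q]; scaling the second
     by the inverse gives a hyperbolic pair. *)
  pose s := sqrtC (- q / p); have sp : s * s * p = - q.
    by rewrite -expr2 sqrtCK divfK.
  have we : form w e = 0 by rewrite form_sym.
  have ssp : s * (s * p) = - q by rewrite mulrA.
  apply: (@zero_weight_no_hyperbolic (e + s *: w) ((2%:R * q)^-1 *: (e - s *: w))).
  - by apply: subspaceD => //; apply: subspaceZ.
  - by apply: subspaceZ => //; apply: subspaceB => //; apply: subspaceZ.
  - by rewrite formDl !formDr !formZl !formZr ew we -/p -/q ssp !mulr0 addr0 add0r subrr.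
  - rewrite formZl formZr formBl !formBr !formZl !formZr ew we -/p -/q ssp.
    by rewrite !mulr0 subr0 sub0r opprK subrr !mulr0.
  - rewrite formZr formDl !formBr !formZl !formZr ew we -/p -/q ssp.
    by rewrite !mulr0 subr0 sub0r opprK -mulr2n -[q *+ 2]mulr_natl mulVf // mulf_neq0.
(* Removing the components along [e] leaves vectors orthogonal to [e], whose pairing vanishes. *)
have formE u v : V0 u -> V0 v -> form u v = form e u * form e v / q.
  move=> V0u V0v.
  have V0p w : V0 w -> V0 (w - (form e w / q) *: e).
    by move=> V0w; apply: subspaceB => //; apply: subspaceZ.
  have ep w : form e (w - (form e w / q) *: e) = 0.
    by rewrite formBr formZr -/q divfK // subrr.
  have := orth _ _ (V0p u V0u) (V0p v V0v) (ep u) (ep v).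
  rewrite formBl formZl ep mulr0 subr0 formBr formZr [form u e]form_sym => /eqP.
  by rewrite subr_eq0 => /eqP ->; rewrite mulrC mulrA.
rewrite (formE a b) // (formE c d) // (formE a c) // (formE b d) //.
rewrite -!mulrA; congr (_ * _); rewrite !mulrA; congr (_ * _ * _).
by rewrite mulrAC [RHS]mulrAC [form e b * _]mulrC.
Qed.

(** For [y] a wedge, the rank-one identity makes [act y u] orthogonal to [V0], so wedges of vectors
    of [V0] kill it. *)
Lemma ext2_zero_weight_mul x y u :
  ext2 V0 x -> ext2 V0 y -> V0 u -> act x (act y u) = 0.
Proof.
move=> V0x + V0u; move: y; apply: linear_span_min.
  split=> [|a y y' /= yu y'u]; first by rewrite /= linear0l linear0r.
  by rewrite linearPl linearPr /= yu y'u scaler0 addr0.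
move=> _ [c V0c [d V0d <-]] /=; move: x V0x; apply: linear_span_min.
  split=> [|k x x' /= xu x'u]; first by rewrite /= linear0l.
  by rewrite linearPl /= xu x'u scaler0 addr0.
move=> _ [a V0a [b V0b <-]] /=; rewrite !act_wedge.
have crossed v : V0 v ->
    form (form u d *: c - form u c *: d) v = 0.
  move=> V0v; rewrite formBl !formZl.
  by rewrite zero_weight_form_rank1 // subrr.
by rewrite !crossed // !scale0r subrr.
Qed.

(** As [t] is central in the centralizer, each argument may be replaced by its part in [ext2 V0].
    The inner bracket then kills [V0], hence commutes with wedges of vectors of [V0]. *)
Lemma centralizer_bracket_bracket x1 x2 x3 :
  z x1 -> z x2 -> z x3 -> bracket (bracket x1 x2) x3 = 0.
Proof.
have tz x y : t x -> z y -> bracket x y = 0 by move=> tx [_]; apply.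
have zE y : z y -> exists2 n, ext2 V0 n &
    forall y', z y' -> bracket y y' = bracket n y'.
  move=> /centralizer_decomposition[x tx V0y]; exists (y - x) => // y' zy'.
  by rewrite linearBl /= (tz x) // subr0.
move=> zx1 zx2 zx3.
have [n1 V01 ->] := zE _ zx1; last exact: zx2.
have zn1 := ext2_zero_weight_centralizer V01.
have [n2 V02 x2E] := zE _ zx2; have zn2 := ext2_zero_weight_centralizer V02.
(* The replacement is available for left arguments only, so the bracket is flipped before and after
   it. *)
rewrite [bracket n1 x2]bracketC x2E // -bracketC.
have zn12 := centralizer_bracket zn1 zn2.
have [n3 V03 x3E] := zE _ zx3.
rewrite [LHS]bracketC x3E // -bracketC.
have [s12 _] := zn12.
have skill := subspace_preimage (bracket (bracket n1 n2)) subspace0.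
move: n3 V03 {x3E}; apply: (linear_span_min skill).
move=> _ [u V0u [v V0v <-]] /=; rewrite (bracket_wedge form_sym) //.
by rewrite !act_bracket !ext2_zero_weight_mul // !subrr linear0l linear0r addr0.
Qed.

Lemma centralizer_direct_sum : direct_sum z t (ext2 V0).
Proof.
split; last exact: toral_ext2_zero_weight.
apply/seteqP; split=> [y /centralizer_decomposition[x tx V0y]|_ [x tx [y V0y <-]]].
  by exists x => //; exists (y - x); rewrite // addrC subrK.
apply: (subspaceD centralizer_subspace); first exact: toral_centralizer.
exact: ext2_zero_weight_centralizer.
Qed.

Lemma centralizer_nilpotent : lie_prod form (lie_prod form z z) z = [set 0].
Proof.
apply/seteqP; split=> [|_ ->]; last exact: (proj1 (linear_span_subspace _)).
apply: (linear_span_min subspace0) => _ [y zzy [x3 zx3 <-]] /=.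
move: y zzy; apply: linear_span_min.
  split=> [|a y y' /= y0 y'0]; first by rewrite /= linear0l.
  by rewrite linearPl /= y0 y'0 scaler0 addr0.
by move=> _ [x1 zx1 [x2 zx2 <-]]; apply: centralizer_bracket_bracket.
Qed.

End Centralizer.

Theorem corollary4p4 (R : realType) (V : lmodType R[i])
    (form : {biscalar V})
    (V_dim : countably_infinite_dimensional V)
    (form_sym : commutative form)
    (form_nondeg : nondegenerate_form form)
    (g : nat -> set (tensor V V))
    (g_exh : reductive_exhaustion form g)
    (t : set (tensor V V))
    (t_max : maximal_toral form g t) :
  let z := centralizer form t in
  [/\ direct_sum z t (ext2 (gen_zero_weight_space form t)),
      lie_subalgebra form z &
      lie_prod form (lie_prod form z z) z = [set 0]].
Proof.
split.
- exact: (centralizer_direct_sum V_dim form_sym form_nondeg g_exh t_max).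
- split; first exact: centralizer_subspace.
  by move=> x y; apply: centralizer_bracket.
- exact: (centralizer_nilpotent V_dim form_sym form_nondeg g_exh t_max).
Qed.
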